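(* Let $\hat\epsilon\ge\epsilon>0$, $a\in\{0,1\}$, $0<\beta<1/2$, and integers $1\le m\le n$ be given. Let $\rho$ be a density operator on $\mathcal{H}_2^{\otimes(m+n)}$ ($\mathcal{H}_2=\mathbb{C}^2$). Let $M=\{|\mu_0\rangle\langle\mu_0|,|\mu_1\rangle\langle\mu_1|\}$ and $N=\{|\nu_0\rangle\langle\nu_0|,|\nu_1\rangle\langle\nu_1|\}$ be two projective measurements on $\mathcal{H}_2$ (so $\{|\mu_0\rangle,|\mu_1\rangle\}$ and $\{|\nu_0\rangle,|\nu_1\rangle\}$ are orthonormal bases), and let $c=\max_{x,y\in\{0,1\}}|\langle\mu_x|\nu_y\rangle|^2$. Consider the following experiment: a subset $t\subset\{1,\dots,m+n\}$ with $|t|=m$ is chosen uniformly at random among all $\binom{m+n}{m}$ such subsets, and each of the $m$ qubits indexed by $t$ is measured with $M$, giving an outcome string $q\in\{0,1\}^m$; let $\rho(t,q)$ denote the resulting normalized post-measurement state of the remaining $n$ qubits. Set $$\delta=\sqrt{\frac{(m+n+2)\ln(2/\epsilon^2)}{m(m+n)}}.$$ Then, with probability at least $1-\hat\epsilon^{\,1-2\beta}$ over the choice of $t$ and the measurement outcome $q$, $$H_\infty^{2\epsilon+2\epsilon^\beta}(N)_{\rho(t,q)}+n\,\bar H\big(w_a(q)+\delta\big)\ \ge\ -n\log_2 c .$$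
   Context: All logarithms are base 2. For a string $q$ over an alphabet and a letter $a$, the relative $a$-Hamming weight is $w_a(q)=|\{i: q_i\ne a\}|/|q|$. The extended binary entropy is $\bar H(x)=-x\log_2 x-(1-x)\log_2(1-x)$ for $x\in[0,1/2]$, $\bar H(x)=0$ for $x<0$, and $\bar H(x)=1$ for $x>1/2$. For a state $\sigma$ on $\mathcal{H}_2^{\otimes n}$, $H_\infty(N)_\sigma=-\log_2\max_{j\in\{0,1\}^n}p_\sigma(j)$, where $p_\sigma(j)=\langle\nu_{j_1}\cdots\nu_{j_n}|\sigma|\nu_{j_1}\cdots\nu_{j_n}\rangle$ is the probability of outcome $j$ when each of the $n$ qubits is measured with $N$. The smooth version is $H_\infty^{\epsilon'}(N)_\rho=\sup\{H_\infty(N)_\sigma:\ \sigma \text{ a density operator on }\mathcal{H}_2^{\otimes n},\ \|\sigma-\rho\|_1\le\epsilon'\}$, where $\|\cdot\|_1$ is the trace norm. *)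

(* Defs.v *)
From Stdlib Require Import Reals List ClassicalDescription.
Open Scope R_scope.

Record cplx := mkC { Cre : R; Cim : R }.
Definition C0 : cplx := mkC 0 0.
Definition C1 : cplx := mkC 1 0.
Definition Cadd (z w : cplx) : cplx := mkC (Cre z + Cre w) (Cim z + Cim w).
Definition Csub (z w : cplx) : cplx := mkC (Cre z - Cre w) (Cim z - Cim w).
Definition Cmul (z w : cplx) : cplx :=
  mkC (Cre z * Cre w - Cim z * Cim w) (Cre z * Cim w + Cim z * Cre w).
Definition Cconj (z : cplx) : cplx := mkC (Cre z) (- Cim z).
Definition Cscale (r : R) (z : cplx) : cplx := mkC (r * Cre z) (r * Cim z).
Definition Cnorm2 (z : cplx) : R := Cre z * Cre z + Cim z * Cim z.

Definition Csum {A : Type} (f : A -> cplx) (l : list A) : cplx :=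
  fold_right (fun x acc => Cadd (f x) acc) C0 l.
Definition Rsum {A : Type} (f : A -> R) (l : list A) : R :=
  fold_right (fun x acc => f x + acc) 0 l.
(* maximum of a list (default 0 on the empty list; only used on nonempty lists) *)
Definition max_list (l : list R) : R :=
  match l with nil => 0 | x :: l' => fold_right Rmax x l' end.

Definition log2 (x : R) : R := ln x / ln 2.

(* A basis vector of H_2^{(x) k} is labelled by a list of k booleans; entry i
   of the list is the computational-basis value of qubit i+1. *)
Fixpoint bits (k : nat) : list (list bool) :=
  match k with
  | O => nil :: nil
  | S k' => map (cons false) (bits k') ++ map (cons true) (bits k')
  end.

Definition lbeq (i j : list bool) : bool :=
  if list_eq_dec Bool.bool_dec i j then true else false.

(* vectors and matrices on H_2^{(x) k} (only values on bits k matter) *)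
Definition Vec := list bool -> cplx.
Definition Mat := list bool -> list bool -> cplx.

Definition inner (k : nat) (u v : Vec) : cplx :=
  Csum (fun i => Cmul (Cconj (u i)) (v i)) (bits k).

Definition quad (k : nat) (X : Mat) (v : Vec) : cplx :=
  Csum (fun i => Csum (fun j => Cmul (Cmul (Cconj (v i)) (X i j)) (v j)) (bits k)) (bits k).

Definition density (k : nat) (rho : Mat) : Prop :=
  (forall i j, In i (bits k) -> In j (bits k) -> rho j i = Cconj (rho i j)) /\
  (forall v : Vec, 0 <= Cre (quad k rho v)) /\
  Csum (fun i => rho i i) (bits k) = C1.

Definition onb (k : nat) (u : list bool -> Vec) : Prop :=
  forall l l', In l (bits k) -> In l' (bits k) ->
    inner k (u l) (u l') = if lbeq l l' then C1 else C0.

Definition Msub (X Y : Mat) : Mat := fun i j => Csub (X i j) (Y i j).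

(* trace norm via the singular value decomposition:
   trace_norm k X s  <->  ||X||_1 = s, i.e. X = sum_l s_l |u_l><w_l| with
   orthonormal bases u, w, s_l >= 0, and s = sum_l s_l. *)
Definition trace_norm (k : nat) (X : Mat) (s : R) : Prop :=
  exists (u w : list bool -> Vec) (sv : list bool -> R),
    onb k u /\ onb k w /\
    (forall l, In l (bits k) -> 0 <= sv l) /\
    (forall x y, In x (bits k) -> In y (bits k) ->
       X x y = Csum (fun l => Cscale (sv l) (Cmul (u l x) (Cconj (w l y)))) (bits k)) /\
    s = Rsum sv (bits k).

(* mu x is the vector |mu_x> in C^2 = (bool -> cplx) *)
Definition qubit_onb (mu : bool -> bool -> cplx) : Prop :=
  forall x y : bool,
    Csum (fun b => Cmul (Cconj (mu x b)) (mu y b)) (false :: true :: nil)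
    = if Bool.eqb x y then C1 else C0.

Definition qinner (mu nu : bool -> bool -> cplx) (x y : bool) : cplx :=
  Csum (fun b => Cmul (Cconj (mu x b)) (nu y b)) (false :: true :: nil).

Definition overlap (mu nu : bool -> bool -> cplx) : R :=
  max_list (map (fun p => Cnorm2 (qinner mu nu (fst p) (snd p)))
              ((false,false) :: (false,true) :: (true,false) :: (true,true) :: nil)).

(* tensor product vector |mu_{q_1}> (x) ... (x) |mu_{q_k}>, evaluated at a *)
Fixpoint prodvec (mu : bool -> bool -> cplx) (q a : list bool) : cplx :=
  match q, a with
  | nil, nil => C1
  | x :: q', b :: a' => Cmul (mu x b) (prodvec mu q' a')
  | _, _ => C0
  end.

Definition pmeas (k : nat) (nu : bool -> bool -> cplx) (sigma : Mat) (j : list bool) : R :=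
  Cre (quad k sigma (prodvec nu j)).

Definition Hmin (k : nat) (nu : bool -> bool -> cplx) (sigma : Mat) : R :=
  - log2 (max_list (map (pmeas k nu sigma) (bits k))).

Definition smooth_Hmin (k : nat) (nu : bool -> bool -> cplx) (eps' : R) (rho : Mat) (h : R) : Prop :=
  is_lub (fun x => exists sigma, density k sigma /\
            (exists s, trace_norm k (Msub sigma rho) s /\ s <= eps') /\
            x = Hmin k nu sigma) h.

(* a subset t of {1..N} with |t| = m is represented as a mask of length N
   with exactly m entries true (position i true <-> qubit i+1 in t). *)
Definition masks (N m : nat) : list (list bool) :=
  filter (fun s => Nat.eqb (length (filter (fun b => b) s)) m) (bits N).

Fixpoint merge (mask a j : list bool) : list bool :=
  match mask with
  | nil => nil
  | true :: ms => match a with x :: a' => x :: merge ms a' j | nil => false :: merge ms nil j end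
  | false :: ms => match j with y :: j' => y :: merge ms a j' | nil => false :: merge ms a nil end
  end.

(* unnormalized post-measurement state of the remaining n qubits after
   measuring the qubits in t with M and obtaining q:  <mu_q|_t rho |mu_q>_t *)
Definition post (m : nat) (mu : bool -> bool -> cplx) (rho : Mat) (t q : list bool) : Mat :=
  fun j j' =>
    Csum (fun a => Csum (fun a' =>
      Cmul (Cmul (Cconj (prodvec mu q a)) (rho (merge t a j) (merge t a' j')))
           (prodvec mu q a')) (bits m)) (bits m).

Definition prob_out (m n : nat) (mu : bool -> bool -> cplx) (rho : Mat) (t q : list bool) : R :=
  Cre (Csum (fun j => post m mu rho t q j j) (bits n)).

Definition post_state (m n : nat) (mu : bool -> bool -> cplx) (rho : Mat) (t q : list bool) : Mat :=
  fun j j' => Cscale (/ prob_out m n mu rho t q) (post m mu rho t q j j').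

Definition wa (a : bool) (q : list bool) : R :=
  INR (length (filter (fun b => negb (Bool.eqb b a)) q)) / INR (length q).

Definition Hbar (x : R) : R :=
  if Rlt_dec x 0 then 0
  else if Rlt_dec (1/2) x then 1
  else - x * log2 x - (1 - x) * log2 (1 - x).

Definition indicator (P : Prop) : R :=
  if excluded_middle_informative P then 1 else 0.

(* Main.v *)
(** Let [w b = <mu_b| rho |mu_b>], and call [j] typical for the outcome [q] when
    [wa j <= wa q + delta].  Serfling's inequality for sampling without replacement (a Hoeffding
    estimate for each draw) shows that the atypical part of the measured distribution [w] has
    mass at most [eps^2 / 2] on average over [t].  By Markov's inequality, outside an event of
    probability [eps^(1 - 2 beta)] the post-measurement state [D] has atypical mass
    [r' <= eps^(1 + 2 beta)].

    For such an outcome let [sigma] be [D] projected to the span of the typical [mu_j] and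
    renormalised.  Diagonalising [sigma - D] in a basis [u_l] and splitting
    [u_l = p_l + q_l] along the projection, AM-GM on the cross term [2 Re <p_l|D|q_l>] with
    weight [kappa] yields [||sigma - D||_1 <= kappa + (2 + / kappa) r'], which for
    [kappa = eps^beta] is below [2 eps + 2 eps^beta].  Finally, [sigma] is supported on at most
    [2^(n Hbar(wa q + delta))] vectors [mu_j], each with [|<mu_j|nu_i>|^2 <= c^n], and
    Cauchy-Schwarz for the form of [D] bounds every outcome probability of [sigma] by
    [2^(n Hbar) c^n]. *)

From Stdlib Require Import Reals List FinFun ClassicalDescription Lra Lia.
Require Import Defs.
From mathcomp Require all_boot all_algebra complex Rstruct.
Open Scope R_scope.

(** * Spectral theorem for Hermitian matrices indexed by bit strings *)

(** Resolution of the identity by the [u l], the dual form of orthonormality: traces and basis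
    expansions are computed with it. *)
Definition complete (k : nat) (u : list bool -> Vec) : Prop :=
  forall x y, In x (bits k) -> In y (bits k) ->
    Csum (fun l => Cmul (u l x) (Cconj (u l y))) (bits k) = if lbeq x y then C1 else C0.

Lemma bits_NoDup k : NoDup (bits k).
Proof.
  induction k as [|k IH]; simpl.
  - repeat constructor; simpl; tauto.
  - apply NoDup_app.
    + apply FinFun.Injective_map_NoDup; [intros x y H; injection H; auto | exact IH].
    + apply FinFun.Injective_map_NoDup; [intros x y H; injection H; auto | exact IH].
    + intros x H1 H2. apply in_map_iff in H1, H2.
      destruct H1 as [y [<- _]], H2 as [z [H2 _]]. discriminate.
Qed.

Module Spectral.
Import all_boot all_algebra complex Rstruct.
Import GRing.Theory Num.Theory.
Set Implicit Arguments. Unset Strict Implicit. Unset Printing Implicit Defensive.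
Local Open Scope ring_scope.
Local Open Scope sesquilinear_scope.
Local Notation CC := (complex R).
Local Notation conjC := (@Num.conj CC).

Definition toC (z : cplx) : CC := Complex (Cre z) (Cim z).
Definition ofC (z : CC) : cplx := mkC (complex.Re z) (complex.Im z).

Lemma ofC_conj (z : CC) : ofC z^* = Cconj (ofC z).
Proof. by case: z. Qed.
Lemma ofC_mul (z w : CC) : ofC (z * w) = Cmul (ofC z) (ofC w).
Proof. by case: z => a b; case: w. Qed.
Lemma toC_conj z : toC (Cconj z) = (toC z)^*.
Proof. by []. Qed.
Lemma toC_mul z w : toC (Cmul z w) = toC z * toC w.
Proof. by []. Qed.
Lemma toCK z : ofC (toC z) = z.
Proof. by case: z. Qed.

Lemma ofC_inj : injective ofC.
Proof. by move=> [a b] [a' b'] [-> ->]. Qed.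

(** Turns sums over bit strings into sums over ordinals, so that entries of matrix products can be
    read as [Csum] expressions. *)
Lemma Csum_ord (A : Type) (x0 : A) (f : A -> cplx) (s : list A) :
  Csum f s = ofC (\sum_(i < size s) toC (f (nth x0 s i))).
Proof.
rewrite -(big_mkord xpredT (fun i => toC (f (nth x0 s i)))) -(big_nth x0 xpredT (fun x => toC (f x))).
elim: s => [|x s IH]; first by rewrite big_nil.
by rewrite big_cons /= IH; case: (f x) => a b; case: (\sum_(j <- s) _).
Qed.

Lemma In_mem (x : list bool) (s : list (list bool)) : In x s <-> x \in s.
Proof.
elim: s => [|y s IH] //=; rewrite in_cons; split.
  by case=> [->|/IH ->]; rewrite ?eqxx ?orbT.
by case/predU1P => [->|/IH]; [left | right].
Qed.

Lemma bits_uniq k : uniq (bits k).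
Proof.
elim: (bits_NoDup k) => [|x s xs _ IH] //=; rewrite IH andbT.
by apply/negP => /In_mem.
Qed.

Lemma ofC_delta (x y : list bool) :
  (if lbeq x y then C1 else C0) = ofC (x == y)%:R.
Proof. by rewrite /lbeq; case: list_eq_dec => [->|/eqP/negPf ->]; rewrite ?eqxx. Qed.

Section Basis.
Variable k : nat.
Notation B := (bits k).
Notation d := (size B).
Notation e i := (nth nil B i).

Lemma In_ord x : In x B -> exists i : 'I_d, x = e i.
Proof.
by move/In_mem => xB; have h := xB; rewrite -index_mem in h; exists (Ordinal h); rewrite /= nth_index.
Qed.

Lemma ord_In (i : 'I_d) : In (e i) B.
Proof. by apply/In_mem/mem_nth. Qed.

Lemma delta_ord (i j : 'I_d) : (if lbeq (e i) (e j) then C1 else C0) = ofC (i == j)%:R.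
Proof. by rewrite ofC_delta nth_uniq ?bits_uniq. Qed.

Definition mat_of (u : list bool -> Vec) : 'M[CC]_d := \matrix_(i, j) toC (u (e i) (e j)).
Definition fun_of (M : 'M[CC]_d) (x y : list bool) : cplx :=
  match insub (index x B), insub (index y B) with
  | Some i, Some j => ofC (M i j)
  | _, _ => C0
  end.

Lemma fun_ofE M (i j : 'I_d) : fun_of M (e i) (e j) = ofC (M i j).
Proof. by rewrite /fun_of !index_uniq ?bits_uniq // !valK. Qed.

(** With the vectors as rows of a square matrix [U], orthonormality says that [conj U] is a left
    inverse of [U^T]. For square matrices it is then a right inverse too, which is completeness. *)
Lemma onb_complete u : onb k u -> complete k u.
Proof.
move=> u1 _ _ /In_ord[i ->] /In_ord[j ->]; pose U := mat_of u.
have UU : map_mx conjC U *m U^T = 1%:M.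
  apply/matrixP => a b; apply: ofC_inj; rewrite !mxE -delta_ord -(u1 _ _ (ord_In a) (ord_In b)).
  rewrite /inner (Csum_ord nil); congr ofC.
  by apply: eq_bigr => l _; rewrite toC_mul toC_conj !mxE.
have /matrixP/(_ i j) := mulmx1C UU.
rewrite (Csum_ord nil) delta_ord !mxE => <-; congr ofC.
by apply: eq_bigr => l _; rewrite toC_mul toC_conj !mxE.
Qed.

Theorem hermitian_spectral (X : Mat) :
  (forall x y, In x B -> In y B -> X y x = Cconj (X x y)) ->
  exists (u : list bool -> Vec) (lam : list bool -> R),
    onb k u /\
    (forall x y, In x B -> In y B ->
      X x y = Csum (fun l => Cscale (lam l) (Cmul (u l x) (Cconj (u l y)))) B).
Proof.
move=> Xh; pose A : 'M[CC]_d := mat_of X.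
have Ah : A \is hermsymmx.
  apply/is_hermitianmxP; rewrite expr0 scale1r; apply/matrixP => i j.
  by rewrite !mxE (Xh _ _ (ord_In j) (ord_In i)).
have Dr := hermitian_spectral_diag_real Ah.
have /orthomx_spectralP := hermitian_normalmx Ah.
have := spectral_unitarymx A; move: (spectralmx A) (spectral_diag A) Dr => P D Dr Pu.
rewrite invmx_unitary // => AE.
(* In [A = P^-1 D P] the rows of [P] are the bras, hence the conjugation. The entries of [D] are
   real because [A] is Hermitian, so taking real parts loses nothing. *)
exists (fun_of (map_mx conjC P)), (fun l => complex.Re (oapp (D 0) 0 (insub (index l B)))).
split.
  move=> _ _ /In_ord[i ->] /In_ord[j ->].
  move/unitarymxP/matrixP/(_ i j): Pu; rewrite delta_ord !mxE => <-.
  rewrite /inner (Csum_ord nil); congr ofC; apply: eq_bigr => l _.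
  by rewrite !fun_ofE -ofC_conj -ofC_mul !mxE conjCK; case: (_ * _).
move=> _ _ /In_ord[i ->] /In_ord[j ->].
rewrite -[LHS]toCK (Csum_ord nil); congr ofC.
have /matrixP/(_ i j) := AE; rewrite !mxE => ->.
apply: eq_bigr => l _; rewrite mul_mx_diag !mxE index_uniq ?bits_uniq // valK /= !fun_ofE !mxE.
have /mxOverP/(_ 0 l) := Dr.
rewrite -ofC_conj -ofC_mul conjCK.
move=> /complex_realP[r ->]; rewrite mulrAC mulrC; case: ((P l i)^* * P l j) => x y.
apply: ofC_inj; rewrite ofC_mul /ofC /Cmul /Cscale /=.
by rewrite !Rmult_0_l Rminus_0_r Rplus_0_r.
Qed.
End Basis.
End Spectral.

(** * Finite sums and sesquilinear forms *)

Lemma cplx_ext z w : Cre z = Cre w -> Cim z = Cim w -> z = w.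
Proof. destruct z, w; simpl; intros -> ->; reflexivity. Qed.

Definition Copp (z : cplx) : cplx := mkC (- Cre z) (- Cim z).

Lemma cplx_ring : ring_theory C0 C1 Cadd Cmul Csub Copp eq.
Proof. constructor; intros; apply cplx_ext; simpl; ring. Qed.
Add Ring cplx_ring : cplx_ring.

Lemma Cconj_add z w : Cconj (Cadd z w) = Cadd (Cconj z) (Cconj w).
Proof. apply cplx_ext; simpl; ring. Qed.
Lemma Cconj_mul z w : Cconj (Cmul z w) = Cmul (Cconj z) (Cconj w).
Proof. apply cplx_ext; simpl; ring. Qed.
Lemma Cconj_conj z : Cconj (Cconj z) = z.
Proof. apply cplx_ext; simpl; ring. Qed.
Lemma Cconj_C0 : Cconj C0 = C0.
Proof. apply cplx_ext; simpl; ring. Qed.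
Lemma Cconj_C1 : Cconj C1 = C1.
Proof. apply cplx_ext; simpl; ring. Qed.
Lemma Cscale_mul r z : Cscale r z = Cmul (mkC r 0) z.
Proof. apply cplx_ext; simpl; ring. Qed.

Section Sums.
Context {A B : Type}.
Implicit Types (l : list A) (f g : A -> R) (F G : A -> cplx).

Lemma Rsum_cons f x l : Rsum f (x :: l) = f x + Rsum f l.
Proof. reflexivity. Qed.
Lemma Rsum_ext f g l : (forall x, In x l -> f x = g x) -> Rsum f l = Rsum g l.
Proof. induction l; simpl; intros H; [reflexivity|]. rewrite H, IHl; auto. Qed.
Lemma Rsum_le f g l : (forall x, In x l -> f x <= g x) -> Rsum f l <= Rsum g l.
Proof. induction l; simpl; intros H; [lra|]. apply Rplus_le_compat; auto. Qed.
Lemma Rsum_0 l : Rsum (fun _ => 0) l = 0.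
Proof. induction l; simpl; lra. Qed.
Lemma Rsum_nonneg f l : (forall x, In x l -> 0 <= f x) -> 0 <= Rsum f l.
Proof. intros H. rewrite <- (Rsum_0 l). apply Rsum_le, H. Qed.
Lemma Rsum_add f g l : Rsum (fun x => f x + g x) l = Rsum f l + Rsum g l.
Proof. induction l; simpl; lra. Qed.
Lemma Rsum_scal c f l : Rsum (fun x => c * f x) l = c * Rsum f l.
Proof. induction l; simpl; lra. Qed.
Lemma Rsum_const c l : Rsum (fun _ => c) l = INR (length l) * c.
Proof. induction l; [simpl; ring|]. cbn [length Rsum fold_right]. rewrite S_INR. unfold Rsum in IHl. lra. Qed.
Lemma Rsum_app f l l' : Rsum f (l ++ l') = Rsum f l + Rsum f l'.
Proof. induction l; simpl; lra. Qed.
Lemma Rsum_map f (h : B -> A) (l : list B) : Rsum f (map h l) = Rsum (fun x => f (h x)) l.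
Proof. induction l; simpl; lra. Qed.

Lemma Csum_cons F x l : Csum F (x :: l) = Cadd (F x) (Csum F l).
Proof. reflexivity. Qed.
Lemma Csum_ext F G l : (forall x, In x l -> F x = G x) -> Csum F l = Csum G l.
Proof. induction l; simpl; intros H; [reflexivity|]. rewrite H, IHl; auto. Qed.
Lemma Csum_0 l : Csum (fun _ => C0) l = C0.
Proof. induction l; [reflexivity|]. rewrite Csum_cons, IHl; ring. Qed.
Lemma Csum_add F G l : Csum (fun x => Cadd (F x) (G x)) l = Cadd (Csum F l) (Csum G l).
Proof. induction l; cbn [app]; [cbn; ring|]. rewrite !Csum_cons, IHl; ring. Qed.
Lemma Csum_mul_l c F l : Csum (fun x => Cmul c (F x)) l = Cmul c (Csum F l).
Proof. induction l; cbn [app]; [cbn; ring|]. rewrite !Csum_cons, IHl; ring. Qed.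
Lemma Csum_mul_r c F l : Csum (fun x => Cmul (F x) c) l = Cmul (Csum F l) c.
Proof. induction l; cbn [app]; [cbn; ring|]. rewrite !Csum_cons, IHl; ring. Qed.
Lemma Cconj_Csum F l : Cconj (Csum F l) = Csum (fun x => Cconj (F x)) l.
Proof. induction l; [apply Cconj_C0|]. rewrite !Csum_cons, Cconj_add, IHl; ring. Qed.
Lemma Cre_Csum F l : Cre (Csum F l) = Rsum (fun x => Cre (F x)) l.
Proof. induction l; [reflexivity|]. rewrite Csum_cons; simpl; rewrite IHl; reflexivity. Qed.
Lemma Csum_app F l l' : Csum F (l ++ l') = Cadd (Csum F l) (Csum F l').
Proof. induction l; cbn [app]; [cbn; ring|]. rewrite !Csum_cons, IHl; ring. Qed.
Lemma Csum_map F (h : B -> A) (l : list B) : Csum F (map h l) = Csum (fun x => F (h x)) l.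
Proof. induction l; [reflexivity|]. cbn [map]. rewrite !Csum_cons, IHl; reflexivity. Qed.
Lemma Csum_split F (T : A -> bool) l :
  Csum F l = Cadd (Csum F (filter T l)) (Csum F (filter (fun x => negb (T x)) l)).
Proof.
  induction l as [|x l IH]; [cbn; ring|].
  cbn [filter]; destruct (T x); cbn [negb]; rewrite !Csum_cons, IH; ring.
Qed.
Lemma Rsum_split f (T : A -> bool) l :
  Rsum f l = Rsum f (filter T l) + Rsum f (filter (fun x => negb (T x)) l).
Proof.
  induction l as [|x l IH]; simpl; [ring|].
  unfold Rsum in *; destruct (T x); simpl; lra.
Qed.
End Sums.

Lemma Csum_swap {A B} (F : A -> B -> cplx) l l' :
  Csum (fun x => Csum (fun y => F x y) l') l = Csum (fun y => Csum (fun x => F x y) l) l'.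
Proof.
  induction l as [|x l IH]; [symmetry; apply Csum_0|].
  rewrite Csum_cons, IH, <- Csum_add. reflexivity.
Qed.
Lemma Rsum_swap {A B} (F : A -> B -> R) l l' :
  Rsum (fun x => Rsum (fun y => F x y) l') l = Rsum (fun y => Rsum (fun x => F x y) l) l'.
Proof.
  induction l as [|x l IH]; [symmetry; apply Rsum_0|].
  rewrite Rsum_cons, IH, <- Rsum_add. reflexivity.
Qed.

Definition Cdelta (x y : list bool) : cplx := if lbeq x y then C1 else C0.

Lemma lbeq_refl x : lbeq x x = true.
Proof. unfold lbeq; destruct list_eq_dec; congruence. Qed.
Lemma lbeq_neq x y : x <> y -> lbeq x y = false.
Proof. unfold lbeq; destruct list_eq_dec; congruence. Qed.
Lemma lbeq_sym x y : lbeq x y = lbeq y x.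
Proof. unfold lbeq; destruct list_eq_dec, list_eq_dec; congruence. Qed.

Lemma Csum_delta x F l : NoDup l -> In x l -> Csum (fun y => Cmul (Cdelta x y) (F y)) l = F x.
Proof.
  induction l as [|y l IH]; [simpl; tauto|].
  rewrite Csum_cons. intros Hn [->|Hx]; inversion Hn as [|? ? Hy Hl]; subst.
  - rewrite (Csum_ext _ (fun _ => C0)), Csum_0.
    + unfold Cdelta; rewrite lbeq_refl; ring.
    + intros z Hz. unfold Cdelta. rewrite lbeq_neq by congruence. ring.
  - rewrite IH by assumption.
    unfold Cdelta. rewrite lbeq_neq by congruence. ring.
Qed.

(** The polarisation of [quad]: [quad k X v] is convertible to [form k X v v], which later [change]
    steps exploit. *)
Definition form (k : nat) (X : Mat) (u v : Vec) : cplx :=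
  Csum (fun i => Csum (fun j => Cmul (Cmul (Cconj (u i)) (X i j)) (v j)) (bits k)) (bits k).
Definition hermitian (k : nat) (X : Mat) : Prop :=
  forall i j, In i (bits k) -> In j (bits k) -> X j i = Cconj (X i j).
Definition lincomb (c : list bool -> cplx) (e : list bool -> Vec) (l : list (list bool)) : Vec :=
  fun x => Csum (fun i => Cmul (c i) (e i x)) l.

Section Forms.
Variable k : nat.

Lemma form_ext X Y u u' v v' :
  (forall x y, In x (bits k) -> In y (bits k) -> X x y = Y x y) ->
  (forall x, In x (bits k) -> u x = u' x) -> (forall x, In x (bits k) -> v x = v' x) ->
  form k X u v = form k Y u' v'.
Proof.
  intros HX Hu Hv. apply Csum_ext; intros x Hx; apply Csum_ext; intros y Hy.
  rewrite HX, Hu, Hv by assumption. reflexivity.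
Qed.

Lemma form_conj X u v : hermitian k X -> form k X v u = Cconj (form k X u v).
Proof.
  intros HX. unfold form. rewrite Cconj_Csum.
  rewrite Csum_swap. apply Csum_ext; intros x Hx. rewrite Cconj_Csum.
  apply Csum_ext; intros y Hy.
  rewrite (HX x y Hx Hy), !Cconj_mul, Cconj_conj. ring.
Qed.

Lemma form_lincomb_l X c e l v :
  form k X (lincomb c e l) v = Csum (fun i => Cmul (Cconj (c i)) (form k X (e i) v)) l.
Proof.
  unfold form, lincomb.
  transitivity (Csum (fun x => Csum (fun i => Cmul (Cconj (c i))
     (Csum (fun y => Cmul (Cmul (Cconj (e i x)) (X x y)) (v y)) (bits k))) l) (bits k)).
  - apply Csum_ext; intros x _.
    rewrite (Csum_ext _ (fun y => Cmul (Cconj (Csum (fun i => Cmul (c i) (e i x)) l))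
       (Cmul (X x y) (v y)))) by (intros; ring).
    rewrite Csum_mul_l, Cconj_Csum, <- Csum_mul_r.
    apply Csum_ext; intros i _. rewrite Cconj_mul, <- !Csum_mul_l.
    apply Csum_ext; intros y _. ring.
  - rewrite Csum_swap. apply Csum_ext; intros i _. apply Csum_mul_l.
Qed.

Lemma form_lincomb_r X c e l v :
  form k X v (lincomb c e l) = Csum (fun i => Cmul (c i) (form k X v (e i))) l.
Proof.
  unfold form, lincomb.
  transitivity (Csum (fun x => Csum (fun i => Cmul (c i)
     (Csum (fun y => Cmul (Cmul (Cconj (v x)) (X x y)) (e i y)) (bits k))) l) (bits k)).
  - apply Csum_ext; intros x _.
    rewrite (Csum_ext _ (fun y => Csum (fun i => Cmul (c i) (Cmul (Cmul (Cconj (v x)) (X x y)) (e i y))) l)).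
    + rewrite Csum_swap. apply Csum_ext; intros i _. apply Csum_mul_l.
    + intros y _. rewrite <- Csum_mul_l. apply Csum_ext; intros; ring.
  - rewrite Csum_swap. apply Csum_ext; intros i _. apply Csum_mul_l.
Qed.

(** Basis independence of the trace: exchanging the sums leaves [sum_l u_l(y) conj(u_l(x))], a
    Kronecker delta. *)
Lemma sum_quad_complete X u :
  complete k u -> Csum (fun l => quad k X (u l)) (bits k) = Csum (fun x => X x x) (bits k).
Proof.
  intros Hu. unfold quad. rewrite Csum_swap. apply Csum_ext; intros x Hx.
  rewrite Csum_swap.
  transitivity (Csum (fun y => Cmul (Cdelta x y) (X x y)) (bits k)).
  - apply Csum_ext; intros y Hy.
    unfold Cdelta. rewrite lbeq_sym, <- (Hu y x Hy Hx), <- Csum_mul_r.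
    apply Csum_ext; intros; ring.
  - apply (Csum_delta x (fun y => X x y)); [apply bits_NoDup | exact Hx].
Qed.

(** The matrix [Q X Q], where [Q] is the sum of [|e_i><e_i|] over [l], spelled out in matrix
    elements; [proj] is [Q] acting on vectors. *)
Definition compress (X : Mat) (e : list bool -> Vec) (l : list (list bool)) : Mat :=
  fun x y => Csum (fun i => Csum (fun j =>
    Cmul (form k X (e i) (e j)) (Cmul (e i x) (Cconj (e j y)))) l) l.
Definition proj (e : list bool -> Vec) (l : list (list bool)) (v : Vec) : Vec :=
  lincomb (fun i => inner k (e i) v) e l.

Lemma form_rank1 (f g : Vec) (z : cplx) u v :
  form k (fun x y => Cmul z (Cmul (f x) (Cconj (g y)))) u v =
  Cmul z (Cmul (Cconj (inner k f u)) (inner k g v)).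
Proof.
  unfold form, inner. rewrite Cconj_Csum, <- Csum_mul_r, <- Csum_mul_l.
  apply Csum_ext; intros x _. rewrite <- !Csum_mul_l. apply Csum_ext; intros y _.
  rewrite Cconj_mul, Cconj_conj. ring.
Qed.

Lemma form_Csum {A} (F : A -> Mat) l u v :
  form k (fun x y => Csum (fun i => F i x y) l) u v = Csum (fun i => form k (F i) u v) l.
Proof.
  unfold form. symmetry. rewrite Csum_swap. apply Csum_ext; intros x _.
  rewrite Csum_swap. apply Csum_ext; intros y _.
  rewrite Csum_mul_r, Csum_mul_l. reflexivity.
Qed.

(** Moves [Q] from the matrix to the vector, so that only forms of [X] itself remain to be estimated
    and positivity is inherited. *)
Lemma quad_compress X e l v : quad k (compress X e l) v = quad k X (proj e l v).
Proof.
  change (form k (compress X e l) v v = form k X (proj e l v) (proj e l v)).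
  unfold compress, proj. rewrite form_lincomb_l.
  rewrite (form_Csum (fun i x y => Csum (fun j =>
    Cmul (form k X (e i) (e j)) (Cmul (e i x) (Cconj (e j y)))) l)).
  apply Csum_ext; intros i _.
  rewrite (form_Csum (fun j x y => Cmul (form k X (e i) (e j)) (Cmul (e i x) (Cconj (e j y))))).
  rewrite form_lincomb_r, <- Csum_mul_l. apply Csum_ext; intros j _.
  rewrite form_rank1. ring.
Qed.

Lemma hermitian_compress X e l : hermitian k X -> hermitian k (compress X e l).
Proof.
  intros HX x y _ _. unfold compress. rewrite Cconj_Csum, Csum_swap.
  apply Csum_ext; intros i _. rewrite Cconj_Csum. apply Csum_ext; intros j _.
  rewrite !Cconj_mul, Cconj_conj, (form_conj X (e i) (e j) HX). ring.
Qed.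

(** Under the trace, orthonormality leaves only the diagonal terms [i = j]. *)
Lemma trace_compress X e l :
  onb k e -> NoDup l -> incl l (bits k) ->
  Csum (fun x => compress X e l x x) (bits k) = Csum (fun i => quad k X (e i)) l.
Proof.
  intros He Hn Hl. unfold compress. rewrite Csum_swap.
  apply Csum_ext; intros i Hi. rewrite Csum_swap.
  transitivity (Csum (fun j => Cmul (Cdelta i j) (form k X (e i) (e j))) l).
  - apply Csum_ext; intros j Hj.
    rewrite Csum_mul_l. unfold Cdelta.
    rewrite lbeq_sym, <- (He j i) by auto. unfold inner.
    rewrite (Csum_ext (fun x => Cmul (e i x) _) (fun x => Cmul (Cconj (e j x)) (e i x))) by (intros; ring).
    ring.
  - apply (Csum_delta i (fun j => form k X (e i) (e j))); assumption.
Qed.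

Lemma proj_full e v x : complete k e -> In x (bits k) -> proj e (bits k) v x = v x.
Proof.
  intros He Hx. unfold proj, lincomb, inner.
  transitivity (Csum (fun y => Cmul (Cdelta x y) (v y)) (bits k)).
  - rewrite (Csum_ext _ (fun i => Csum (fun y => Cmul (Cmul (Cconj (e i y)) (v y)) (e i x)) (bits k)))
      by (intros; symmetry; apply Csum_mul_r).
    rewrite Csum_swap. apply Csum_ext; intros y Hy.
    unfold Cdelta. rewrite <- (He x y Hx Hy), <- Csum_mul_r. apply Csum_ext; intros; ring.
  - apply Csum_delta; [apply bits_NoDup | exact Hx].
Qed.

End Forms.

(** * Projecting a state *)

Definition psd (k : nat) (X : Mat) : Prop := forall v : Vec, 0 <= Cre (quad k X v).
Definition comb (a : cplx) (u : Vec) (b : cplx) (v : Vec) : Vec :=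
  fun x => Cadd (Cmul a (u x)) (Cmul b (v x)).

Lemma Cre_quad_comb k X a u b v : hermitian k X ->
  Cre (quad k X (comb a u b v)) =
  Cnorm2 a * Cre (quad k X u) + Cnorm2 b * Cre (quad k X v) +
  2 * Cre (Cmul (Cmul (Cconj a) b) (form k X u v)).
Proof.
  intros HX.
  assert (E : quad k X (comb a u b v) =
    Cadd (Cadd (Cmul (Cmul (Cconj a) a) (form k X u u)) (Cmul (Cmul (Cconj b) b) (form k X v v)))
      (Cadd (Cmul (Cmul (Cconj a) b) (form k X u v)) (Cmul (Cmul (Cconj b) a) (form k X v u)))).
  { unfold quad, form, comb. rewrite <- !Csum_mul_l, <- !Csum_add.
    apply Csum_ext; intros x _. rewrite <- !Csum_mul_l, <- !Csum_add.
    apply Csum_ext; intros y _. rewrite !Cconj_add, !Cconj_mul. ring. }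
  assert (Eim : forall w, Cim (form k X w w) = 0).
  { intros w. pose proof (f_equal Cim (form_conj k X w w HX)) as E'. simpl in E'. lra. }
  rewrite E, (form_conj k X u v HX).
  change (quad k X u) with (form k X u u). change (quad k X v) with (form k X v v).
  cbn -[form]. rewrite !Eim. unfold Cnorm2. ring.
Qed.

(** Positivity of [X] at [kappa p + q] and at [- kappa p + q], divided by [kappa], bounds the cross
    term [2 Re <p|X|q>] in absolute value by [kappa <p|X|p> + <q|X|q> / kappa]. *)
Lemma quad_perturb k X p q kappa : hermitian k X -> psd k X -> 0 < kappa ->
  Rabs (Cre (quad k X (comb C1 p C1 q)) - Cre (quad k X p)) <=
  kappa * Cre (quad k X p) + (1 + / kappa) * Cre (quad k X q).
Proof.
  intros HX HP Hk.
  pose proof (HP (comb (mkC kappa 0) p C1 q)) as H1.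
  pose proof (HP (comb (mkC (- kappa) 0) p C1 q)) as H2.
  pose proof (HP q) as Hq.
  rewrite Cre_quad_comb in H1, H2 |- * by assumption.
  cbn -[quad form] in H1, H2 |- *. unfold Cnorm2 in *. cbn -[quad form] in H1, H2 |- *.
  set (P := Cre (quad k X p)) in *. set (Q := Cre (quad k X q)) in *.
  set (F := Cre (form k X p q)) in *. set (G := Cim (form k X p q)) in *.
  assert (E : / kappa * kappa = 1) by (apply Rinv_l; lra).
  assert (Hi : 0 < / kappa) by (apply Rinv_0_lt_compat; lra).
  set (i := / kappa) in *.
  assert (H1' : 0 <= i * (kappa * kappa * P + Q + 2 * (kappa * F))).
  { apply Rmult_le_pos; [lra|]. replace (kappa * kappa * P + Q + 2 * (kappa * F)) with
     ((kappa * kappa + 0 * 0) * P + (1 * 1 + 0 * 0) * Q +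
     2 * ((kappa * 1 - - 0 * 0) * F - (kappa * 0 + - 0 * 1) * G)) by ring. exact H1. }
  assert (H2' : 0 <= i * (kappa * kappa * P + Q - 2 * (kappa * F))).
  { apply Rmult_le_pos; [lra|]. replace (kappa * kappa * P + Q - 2 * (kappa * F)) with
     ((- kappa * - kappa + 0 * 0) * P + (1 * 1 + 0 * 0) * Q +
     2 * ((- kappa * 1 - - 0 * 0) * F - (- kappa * 0 + - 0 * 1) * G)) by ring. exact H2. }
  replace (i * (kappa * kappa * P + Q + 2 * (kappa * F))) with
    ((i * kappa) * kappa * P + i * Q + 2 * (i * kappa * F)) in H1' by ring.
  replace (i * (kappa * kappa * P + Q - 2 * (kappa * F))) with
    ((i * kappa) * kappa * P + i * Q - 2 * (i * kappa * F)) in H2' by ring.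
  rewrite E in H1', H2'.
  apply Rabs_le. lra.
Qed.

(* Cauchy-Schwarz for the semi-definite form, obtained by summing the positivity of [X] on
   [conj c_j e_i - conj c_i e_j] over all pairs. *)
Lemma quad_lincomb_le k X c e l : hermitian k X -> psd k X ->
  Cre (quad k X (lincomb c e l)) <=
  Rsum (fun i => Cnorm2 (c i)) l * Rsum (fun i => Cre (quad k X (e i))) l.
Proof.
  intros HX HP.
  set (a := fun i j => Cre (Cmul (Cmul (Cconj (c i)) (c j)) (form k X (e i) (e j)))).
  assert (E : Cre (quad k X (lincomb c e l)) = Rsum (fun i => Rsum (fun j => a i j) l) l).
  { change (quad k X (lincomb c e l)) with (form k X (lincomb c e l) (lincomb c e l)).
    rewrite form_lincomb_l, Cre_Csum. apply Rsum_ext; intros i _.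
    rewrite form_lincomb_r, <- Csum_mul_l, Cre_Csum. apply Rsum_ext; intros j _.
    unfold a. f_equal. ring. }
  set (d := fun i => Cre (quad k X (e i))).
  assert (Hp : forall i j, 2 * a i j <= Cnorm2 (c j) * d i + Cnorm2 (c i) * d j).
  { intros i j. pose proof (HP (comb (Cconj (c j)) (e i) (Copp (Cconj (c i))) (e j))) as H.
    rewrite Cre_quad_comb in H by assumption.
    replace (Cmul (Cmul (Cconj (Cconj (c j))) (Copp (Cconj (c i)))) (form k X (e i) (e j)))
      with (Copp (Cmul (Cmul (Cconj (c i)) (c j)) (form k X (e i) (e j)))) in H
      by (rewrite Cconj_conj; ring).
    replace (Cnorm2 (Cconj (c j))) with (Cnorm2 (c j)) in H by (unfold Cnorm2; simpl; ring).
    replace (Cnorm2 (Copp (Cconj (c i)))) with (Cnorm2 (c i)) in H by (unfold Cnorm2; simpl; ring).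
    change (Cre (Copp (Cmul (Cmul (Cconj (c i)) (c j)) (form k X (e i) (e j))))) with (- a i j) in H.
    fold (d i) (d j) in H. lra. }
  rewrite E.
  assert (2 * Rsum (fun i => Rsum (fun j => a i j) l) l <=
    2 * (Rsum (fun i => Cnorm2 (c i)) l * Rsum d l)); [|unfold d in *; lra].
  rewrite <- Rsum_scal.
  transitivity (Rsum (fun i => Rsum (fun j => Cnorm2 (c j) * d i + Cnorm2 (c i) * d j) l) l).
  - apply Rsum_le; intros i _. rewrite <- Rsum_scal. apply Rsum_le; intros j _. apply Hp.
  - apply Req_le.
    rewrite (Rsum_ext _ (fun i => Rsum (fun j => Cnorm2 (c j)) l * d i + Rsum d l * Cnorm2 (c i))).
    + rewrite Rsum_add, !Rsum_scal. ring.
    + intros i _. rewrite Rsum_add, Rsum_scal.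
      rewrite (Rsum_ext (fun j => Cnorm2 (c j) * d i) (fun j => d i * Cnorm2 (c j))) by (intros; ring).
      rewrite Rsum_scal. ring.
Qed.

(** The singular values of a Hermitian matrix are the absolute values of its eigenvalues, and these
    are its diagonal entries in an eigenbasis. Assuming the bound for every orthonormal basis spares
    the caller from handling that eigenbasis. *)
Lemma trace_norm_le k X b : hermitian k X ->
  (forall u, onb k u -> Rsum (fun l => Rabs (Cre (quad k X (u l)))) (bits k) <= b) ->
  exists s, trace_norm k X s /\ s <= b.
Proof.
  intros HX Hb. destruct (Spectral.hermitian_spectral HX) as (u & lam & Hu & HE).
  assert (Hlam : forall l, In l (bits k) -> Cre (quad k X (u l)) = lam l).
  { intros l Hl. change (quad k X (u l)) with (form k X (u l) (u l)).
    rewrite (form_ext k X (fun x y => Csum (fun i => Cmul (mkC (lam i) 0) (Cmul (u i x) (Cconj (u i y)))) (bits k))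
      (u l) (u l) (u l) (u l)); auto.
    2: { intros x y Hx Hy. rewrite (HE x y Hx Hy). apply Csum_ext; intros; apply Cscale_mul. }
    rewrite (form_Csum k (fun i x y => Cmul (mkC (lam i) 0) (Cmul (u i x) (Cconj (u i y))))).
    rewrite (Csum_ext _ (fun i => Cmul (Cdelta l i) (mkC (lam i) 0))).
    - rewrite (Csum_delta l (fun i => mkC (lam i) 0)); [reflexivity|apply bits_NoDup|exact Hl].
    - intros i Hi. rewrite form_rank1, (Hu i l Hi Hl), lbeq_sym.
      unfold Cdelta. destruct (lbeq l i); rewrite ?Cconj_C0, ?Cconj_C1; ring. }
  (* Moving the sign of the eigenvalue into one of the two vectors makes the spectral decomposition
     a singular value decomposition. The value 1 at eigenvalue 0 keeps that vector normalised. *)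
  set (sg := fun l => if Rlt_dec (lam l) 0 then -1 else 1).
  exists (Rsum (fun l => Rabs (lam l)) (bits k)). split.
  - exists u, (fun l x => Cscale (sg l) (u l x)), (fun l => Rabs (lam l)).
    split; [exact Hu|]. split; [|split; [intros; apply Rabs_pos|split; [|reflexivity]]].
    + intros l l' Hl Hl'.
      transitivity (Cmul (Cmul (mkC (sg l) 0) (mkC (sg l') 0)) (inner k (u l) (u l'))).
      * unfold inner. rewrite <- Csum_mul_l. apply Csum_ext; intros x _.
        apply cplx_ext; simpl; ring.
      * rewrite (Hu l l' Hl Hl'). unfold lbeq. destruct list_eq_dec as [<-|]; [|ring].
        unfold sg. destruct Rlt_dec; apply cplx_ext; simpl; ring.
    + intros x y Hx Hy. rewrite (HE x y Hx Hy). apply Csum_ext; intros l _.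
      unfold sg. destruct Rlt_dec.
      * rewrite Rabs_left by lra. apply cplx_ext; simpl; ring.
      * rewrite Rabs_right by lra. apply cplx_ext; simpl; ring.
  - rewrite (Rsum_ext _ (fun l => Rabs (Cre (quad k X (u l))))); [apply Hb, Hu|].
    intros l Hl. rewrite Hlam; auto.
Qed.

Definition project (k : nat) (D : Mat) (e : list bool -> Vec) (T : list bool -> bool) : Mat :=
  let S := filter T (bits k) in
  fun x y => Cscale (/ Rsum (fun i => Cre (quad k D (e i))) S) (compress k D e S x y).

Section Projection.
Variables (k : nat) (D : Mat) (e : list bool -> Vec) (T : list bool -> bool).
Hypotheses (HD : density k D) (He : onb k e).
Notation S := (filter T (bits k)).
Notation S' := (filter (fun x => negb (T x)) (bits k)).
Notation r := (Rsum (fun i => Cre (quad k D (e i))) S).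
Notation r' := (Rsum (fun i => Cre (quad k D (e i))) S').
Hypothesis Hr : 0 < r.

Lemma quad_project v : quad k (project k D e T) v = Cscale (/ r) (quad k D (proj k e S v)).
Proof using.
  rewrite <- quad_compress, Cscale_mul. unfold quad at 1 3, project. cbv beta zeta.
  rewrite <- Csum_mul_l. apply Csum_ext; intros x _.
  rewrite <- Csum_mul_l. apply Csum_ext; intros y _. rewrite Cscale_mul. ring.
Qed.

Lemma Cre_sum_quad u : complete k u -> Rsum (fun l => Cre (quad k D (u l))) (bits k) = 1.
Proof using HD.
  intros Hu. rewrite <- Cre_Csum, sum_quad_complete by assumption.
  destruct HD as (_ & _ & E). rewrite E. reflexivity.
Qed.

(** Both sides are the trace of the compression of [D], computed in the basis [u] and in the basis
    [e]. The set [U] is left free because both the typical strings and their complement are used. *)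
Lemma Cre_sum_quad_proj (U : list bool -> bool) u : complete k u ->
  Rsum (fun l => Cre (quad k D (proj k e (filter U (bits k)) (u l)))) (bits k) =
  Rsum (fun i => Cre (quad k D (e i))) (filter U (bits k)).
Proof using He.
  intros Hu. rewrite <- !Cre_Csum. f_equal.
  rewrite <- (trace_compress k D e (filter U (bits k)) He).
  - rewrite <- (sum_quad_complete k _ u Hu). apply Csum_ext; intros; symmetry; apply quad_compress.
  - apply NoDup_filter, bits_NoDup.
  - apply incl_filter.
Qed.

Lemma project_density : density k (project k D e T).
Proof using HD He Hr.
  destruct HD as (HH & HP & HT). split; [|split].
  - intros x y Hx Hy. unfold project.
    rewrite (hermitian_compress k D e S HH x y Hx Hy). apply cplx_ext; simpl; ring.
  - intros v. rewrite quad_project. simpl. apply Rmult_le_pos; [|apply HP].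
    left; apply Rinv_0_lt_compat, Hr.
  - unfold project.
    rewrite (Csum_ext _ (fun x => Cmul (mkC (/ r) 0) (compress k D e S x x)))
      by (intros; apply Cscale_mul).
    rewrite Csum_mul_l, trace_compress;
      [|exact He|apply NoDup_filter, bits_NoDup|apply incl_filter].
    assert (E : Csum (fun i => quad k D (e i)) S = mkC r 0).
    { apply cplx_ext; [apply Cre_Csum|]. cbn -[quad Csum].
      pose proof (Cconj_Csum (fun i => quad k D (e i)) S) as E.
      rewrite (Csum_ext (fun x => Cconj _) (fun i => quad k D (e i))) in E.
      - apply (f_equal Cim) in E. cbn -[quad Csum] in E. lra.
      - intros i _. symmetry. apply (form_conj k D (e i) (e i) HH). }
    rewrite E. apply cplx_ext; cbn -[Rsum quad]; field; lra.
Qed.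

Lemma trace_norm_project kappa : 0 < kappa ->
  exists s, trace_norm k (Msub (project k D e T) D) s /\ s <= kappa + (2 + / kappa) * r'.
Proof using HD He Hr.
  intros Hk. pose proof project_density as (HH' & _ & _).
  pose proof HD as (HH & HP & HT).
  pose proof (Cre_sum_quad e (Spectral.onb_complete He)) as Hone.
  rewrite (Rsum_split _ T) in Hone.
  assert (Hr' : 0 <= r') by (apply Rsum_nonneg; intros; apply HP).
  apply trace_norm_le.
  { intros x y Hx Hy. unfold Msub. rewrite (HH' x y Hx Hy), (HH x y Hx Hy).
    apply cplx_ext; simpl; ring. }
  intros u Hu. apply Spectral.onb_complete in Hu.
  (* With [u_l = p + q], the entry of [sigma - D] is [(/ r - 1) <p|D|p>] minus the change of the
     form of [D] from [p] to [p + q]. The first term is non-negative because [r <= 1];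
     [quad_perturb] controls the second. *)
  transitivity (Rsum (fun l => (/ r - 1 + kappa) * Cre (quad k D (proj k e S (u l))) +
     (1 + / kappa) * Cre (quad k D (proj k e S' (u l)))) (bits k)).
  - apply Rsum_le; intros l _.
    set (p := proj k e S (u l)). set (q := proj k e S' (u l)).
    assert (E : Cre (quad k (Msub (project k D e T) D) (u l)) =
      / r * Cre (quad k D p) - Cre (quad k D (comb C1 p C1 q))).
    { assert (E1 : quad k D (u l) = quad k D (comb C1 p C1 q)).
      { change (form k D (u l) (u l) = form k D (comb C1 p C1 q) (comb C1 p C1 q)).
        assert (Ex : forall x, In x (bits k) -> u l x = comb C1 p C1 q x).
        { intros x Hx. rewrite <- (proj_full k e (u l) x (Spectral.onb_complete He) Hx).
          unfold proj at 1, lincomb. rewrite (Csum_split _ T). unfold comb, p, q, proj, lincomb. ring. }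
        apply form_ext; auto. }
      rewrite <- E1.
      assert (E2 : Cre (quad k (project k D e T) (u l)) = / r * Cre (quad k D p))
        by (rewrite quad_project; reflexivity).
      rewrite <- E2. unfold quad. rewrite !Cre_Csum.
      apply (Rplus_eq_reg_r (Rsum (fun x => Cre (Csum (fun j => Cmul (Cmul (Cconj (u l x)) (D x j)) (u l j)) (bits k))) (bits k))).
      transitivity (Rsum (fun x => Cre (Csum (fun j => Cmul (Cmul (Cconj (u l x)) (project k D e T x j)) (u l j)) (bits k))) (bits k)); [|ring].
      rewrite <- Rsum_add. apply Rsum_ext; intros x _. rewrite !Cre_Csum, <- Rsum_add.
      apply Rsum_ext; intros y _. simpl. ring. }
    rewrite E.
    pose proof (quad_perturb k D p q kappa HH HP Hk) as Hpq.
    assert (Hir : 1 <= / r) by (rewrite <- Rinv_1; apply Rinv_le_contravar; lra).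
    pose proof (HP p) as Hp.
    pose proof (Rmult_le_pos (/ r - 1) _ ltac:(lra) Hp) as Hm.
    replace (/ r * Cre (quad k D p) - Cre (quad k D (comb C1 p C1 q))) with
      ((/ r - 1) * Cre (quad k D p) - (Cre (quad k D (comb C1 p C1 q)) - Cre (quad k D p))) by ring.
    eapply Rle_trans; [apply Rabs_triang|]. rewrite Rabs_Ropp, (Rabs_right ((/ r - 1) * _)) by lra.
    lra.
  (* The total is [(1 - r) + kappa r + (1 + / kappa) r']. Since [1 - r = r'], this equals
     [kappa + (2 + / kappa) r'] up to the dropped term [- kappa r']. *)
  - rewrite Rsum_add, !Rsum_scal.
    rewrite (Cre_sum_quad_proj T u Hu), (Cre_sum_quad_proj (fun x => negb (T x)) u Hu).
    assert (Eq : (/ r - 1 + kappa) * r = 1 - r + kappa * r) by (field; lra).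
    rewrite Eq.
    assert (0 < / kappa) by (apply Rinv_0_lt_compat; lra).
    pose proof (Rmult_le_pos kappa r' ltac:(lra) Hr').
    replace (kappa * r) with (kappa - kappa * r') by (replace r with (1 - r') by lra; ring).
    lra.
Qed.

(** Cauchy-Schwarz produces the factor [r], which cancels the normalisation of [project]; what
    remains is the sum of the squared overlaps over the typical indices. *)
Lemma quad_project_le v c : (forall i, In i S -> Cnorm2 (inner k (e i) v) <= c) ->
  Cre (quad k (project k D e T) v) <= INR (length S) * c.
Proof using HD Hr.
  intros Hc. pose proof HD as (HH & HP & _).
  rewrite quad_project. simpl.
  apply (Rmult_le_reg_l r); [exact Hr|]. rewrite <- Rmult_assoc, Rinv_r, Rmult_1_l by lra.
  eapply Rle_trans; [apply quad_lincomb_le; assumption|].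
  rewrite Rmult_comm. apply Rmult_le_compat_l; [lra|].
  rewrite <- Rsum_const. apply Rsum_le, Hc.
Qed.

End Projection.

(** * Sampling without replacement *)

(** The difference [g] of the logarithms satisfies [g 0 = g' 0 = 0], and [g''] is the square of
    [y - 1/2] for the tilted probability [y = p exp x / W x]. Two uses of the mean value theorem
    give [0 <= g u]. *)
Lemma hoeffding_two_point p u : 0 <= p <= 1 -> 0 <= u ->
  1 - p + p * exp u <= exp (p * u + u ^ 2 / 8).
Proof.
  intros Hp Hu.
  assert (Hpos : forall x, 0 < 1 - p + p * exp x).
  { intros x. pose proof (exp_pos x). destruct (Req_dec p 1); nra. }
  set (W := fun x => 1 - p + p * exp x).
  set (g := fun x => p * x + x ^ 2 / 8 - ln (W x)).
  set (g' := fun x => p + x / 4 - p * exp x / W x).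
  set (g'' := fun x => / 4 - p * exp x / W x * (1 - p * exp x / W x)).
  assert (HW : forall x, derivable_pt_lim W x (p * exp x)).
  { intros x. unfold W. replace (p * exp x) with (0 + p * exp x) by ring.
    apply (derivable_pt_lim_plus (fun _ => 1 - p) (fun x => p * exp x)).
    - apply derivable_pt_lim_const.
    - apply (derivable_pt_lim_scal exp). apply derivable_pt_lim_exp. }
  assert (Hg : forall x, derivable_pt_lim g x (g' x)).
  { intros x. unfold g, g'.
    apply (derivable_pt_lim_minus (fun x => p * x + x ^ 2 / 8) (fun x => ln (W x))).
    - replace (p + x / 4) with (p * 1 + / 8 * (INR 2 * x ^ 1)) by (simpl; field).
      apply (derivable_pt_lim_plus (fun x => p * x) (fun x => x ^ 2 / 8)).
      + apply (derivable_pt_lim_scal id). apply derivable_pt_lim_id.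
      + unfold Rdiv. eapply derivable_pt_lim_ext;
          [intros z; apply Rmult_comm|].
        apply (derivable_pt_lim_scal (fun x => x ^ 2)). apply (derivable_pt_lim_pow x 2).
    - unfold Rdiv. rewrite (Rmult_comm _ (/ W x)).
      apply (derivable_pt_lim_comp W ln); [apply HW | apply derivable_pt_lim_ln, Hpos]. }
  assert (Hg' : forall x, derivable_pt_lim g' x (g'' x)).
  { intros x. unfold g', g''.
    replace (/ 4 - p * exp x / W x * (1 - p * exp x / W x)) with
      ((0 + / 4) - (p * exp x * W x - p * exp x * (p * exp x)) / Rsqr (W x)).
    2: { unfold Rsqr. pose proof (Hpos x). fold (W x) in *. field. lra. }
    apply (derivable_pt_lim_minus (fun x => p + x / 4) (fun x => p * exp x / W x)).
    - apply (derivable_pt_lim_plus (fun _ => p) (fun x => x / 4)).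
      + apply derivable_pt_lim_const.
      + pose proof (derivable_pt_lim_scal id (/ 4) x 1 (derivable_pt_lim_id x)) as H.
        rewrite Rmult_1_r in H. eapply derivable_pt_lim_ext; [|exact H].
        intros z. unfold mult_real_fct, id. field.
    - apply (derivable_pt_lim_div (fun x => p * exp x) W).
      + apply (derivable_pt_lim_scal exp). apply derivable_pt_lim_exp.
      + apply HW.
      + pose proof (Hpos x). fold (W x) in *. lra. }
  assert (Hg'' : forall x, 0 <= g'' x).
  { intros x. unfold g''. set (y := p * exp x / W x). pose proof (Rle_0_sqr (y - / 2)) as H.
    unfold Rsqr in H. nra. }
  assert (W0 : W 0 = 1) by (unfold W; rewrite exp_0; ring).
  assert (g0 : g 0 = 0) by (unfold g; rewrite W0, ln_1; field).
  assert (g'0 : g' 0 = 0) by (unfold g'; rewrite W0, exp_0; field).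
  assert (Hg'pos : forall x, 0 <= x -> 0 <= g' x).
  { intros x [Hx|<-]; [|lra].
    destruct (MVT_cor2 g' g'' 0 x Hx) as (c & E & _); [intros; apply Hg'|].
    pose proof (Rmult_le_pos (g'' c) (x - 0) (Hg'' c) ltac:(lra)). lra. }
  assert (Hgu : 0 <= g u).
  { destruct Hu as [Hu|<-]; [|lra].
    destruct (MVT_cor2 g g' 0 u Hu) as (c & E & Hc); [intros; apply Hg|].
    pose proof (Rmult_le_pos (g' c) (u - 0) (Hg'pos c ltac:(lra)) ltac:(lra)). lra. }
  unfold g in Hgu. rewrite <- (exp_ln (1 - p + p * exp u)) by apply Hpos.
  fold (W u). destruct (Req_dec (ln (W u)) (p * u + u ^ 2 / 8)) as [->|]; [lra|].
  left; apply exp_increasing. lra.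
Qed.

(** All possible first draws from a list, each with the entries left over. *)
Fixpoint picks {A} (l : list A) : list (A * list A) :=
  match l with
  | nil => nil
  | x :: l' => (x, l') :: map (fun p => (fst p, x :: snd p)) (picks l')
  end.

Definition weight (z : R) (x : bool) : R := if x then z else 1.
(* The elementary symmetric polynomial of degree [m] in the weights of the entries of [b]: up to
   the factor [C N m] it is the generating function of the number of ones in a random [m]-sample. *)
Fixpoint esym (z : R) (b : list bool) (m : nat) : R :=
  match b, m with
  | _, O => 1
  | nil, S _ => 0
  | x :: b', S m' => weight z x * esym z b' m' + esym z b' m
  end.
Definition ones (b : list bool) : nat := length (filter (fun x => x) b).

Lemma esym_0 z b : esym z b 0 = 1.
Proof. destruct b; reflexivity. Qed.

(** Double counting: every sample of size [m + 1] arises from [m + 1] choices of its first draw,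
    followed by an [m]-sample of the rest. This permits induction on the sample size. *)
Lemma esym_picks z b m :
  INR (S m) * esym z b (S m) = Rsum (fun p => weight z (fst p) * esym z (snd p) m) (picks b).
Proof.
  revert m; induction b as [|x b IH]; intros m; [simpl; ring|].
  cbn [picks]. rewrite Rsum_cons, Rsum_map. cbn [fst snd esym].
  destruct m as [|m].
  - specialize (IH 0%nat). rewrite esym_0.
    rewrite (Rsum_ext _ (fun p => weight z (fst p) * esym z (snd p) 0)).
    + rewrite <- IH. simpl. ring.
    + intros p _. rewrite esym_0. reflexivity.
  - rewrite (Rsum_ext _ (fun p => weight z x * (weight z (fst p) * esym z (snd p) m) +
       weight z (fst p) * esym z (snd p) (S m))) by (intros; cbn [esym]; ring).
    rewrite Rsum_add, Rsum_scal, <- !IH, (S_INR (S m)). ring.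
Qed.

Lemma picks_spec (b : list bool) x r : In (x, r) (picks b) ->
  length b = S (length r) /\ ones b = ((if x then 1 else 0) + ones r)%nat.
Proof.
  revert x r; induction b as [|y b IH]; intros x r; [simpl; tauto|].
  cbn [picks]. intros [H|H].
  - injection H as <- <-. split; [reflexivity|]. unfold ones; simpl. destruct y; reflexivity.
  - apply in_map_iff in H. destruct H as [[x' r'] [H Hin]]. injection H as <- <-.
    destruct (IH x' r' Hin) as [H1 H2]. simpl in *. split; [lia|].
    unfold ones in *; simpl. destruct y; simpl; lia.
Qed.

Lemma Rsum_picks (f : bool -> R) b :
  Rsum (fun p => f (fst p)) (picks b) = INR (ones b) * f true + (INR (length b) - INR (ones b)) * f false.
Proof.
  induction b as [|x b IH]; [unfold ones; simpl; ring|].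
  cbn [picks]. rewrite Rsum_cons, Rsum_map. cbn [fst]. rewrite IH.
  unfold ones; cbn [filter length]. destruct x; cbn [length]; rewrite !S_INR; ring.
Qed.

Lemma C_succ N m : (m <= N)%nat ->
  INR (S N) * Binomial.C N m = INR (S m) * Binomial.C (S N) (S m).
Proof.
  intros H. unfold Binomial.C. rewrite !fact_simpl, !mult_INR. cbn [Nat.sub].
  pose proof (INR_fact_neq_0 m). pose proof (INR_fact_neq_0 (N - m)).
  pose proof (not_0_INR (S m) ltac:(lia)). field. auto.
Qed.

Lemma C_pos N m : 0 < Binomial.C N m.
Proof.
  unfold Binomial.C. apply Rdiv_lt_0_compat; [|apply Rmult_lt_0_compat];
  apply INR_fact_lt_0.
Qed.

Lemma C_0 N : Binomial.C N 0 = 1.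
Proof.
  unfold Binomial.C. rewrite Nat.sub_0_r. simpl. field. apply INR_fact_neq_0.
Qed.

Lemma esym_1 n m b : length b = (m + n)%nat -> esym 1 b m = Binomial.C (m + n) m.
Proof.
  revert b; induction m as [|m IH]; intros b Hb.
  - rewrite esym_0, C_0. reflexivity.
  - apply (Rmult_eq_reg_l (INR (S m))); [|apply not_0_INR; lia].
    rewrite esym_picks. cbn [Nat.add]. rewrite <- C_succ by lia.
    rewrite (Rsum_ext _ (fun p => (fun _ => Binomial.C (m + n) m) (fst p))).
    + rewrite (Rsum_picks (fun _ => Binomial.C (m + n) m)), Hb. cbn [Nat.add]. ring.
    + intros [x r] Hin. apply picks_spec in Hin as [Hl _]. cbn [fst snd].
      rewrite IH by lia. destruct x; simpl; ring.
Qed.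

(* [n^2 * sum_(n <= j < n + m) 1 / j^2]: the draw made when [j + 1] entries remain changes the
   conditional mean of the sampled count by a two-valued step of width [n / j]. *)
Fixpoint variance (n m : nat) : R :=
  match m with
  | O => 0
  | S m' => INR n ^ 2 / INR (m' + n) ^ 2 + variance n m'
  end.

(** Induction on the sample size, conditioning on the first draw. The population shrinks together
    with the sample, so the number [n] of unsampled entries stays fixed. *)
Lemma esym_exp_le n m b lam : (1 <= n)%nat -> 0 <= lam -> length b = (m + n)%nat ->
  esym (exp lam) b m <=
  Binomial.C (m + n) m * exp (lam * INR m * INR (ones b) / INR (m + n) + lam ^ 2 / 8 * variance n m).
Proof.
  intros Hn Hlam. revert b; induction m as [|m IH]; intros b Hb.
  - rewrite esym_0, C_0. simpl. right.
    replace (lam * 0 * INR (ones b) / INR n + lam * (lam * 1) / 8 * 0) with 0; [rewrite exp_0; ring|].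
    field. apply not_0_INR; lia.
  - apply (Rmult_le_reg_l (INR (S m))); [apply lt_0_INR; lia|].
    rewrite esym_picks, <- Rmult_assoc. cbn [Nat.add]. rewrite <- C_succ by lia.
    set (N := INR (m + n)). set (K := INR (ones b)). set (V := lam ^ 2 / 8 * variance n m).
    set (cc := Binomial.C (m + n) m).
    assert (HN : 0 < N) by (apply lt_0_INR; lia).
    assert (EN : INR (S (m + n)) = N + 1) by apply S_INR.
    assert (ENmn : N = INR m + INR n) by apply plus_INR.
    assert (HK : 0 <= K <= N + 1).
    { split; [apply pos_INR|]. rewrite <- EN. apply le_INR. unfold ones.
      cbn [Nat.add] in Hb. rewrite <- Hb. apply filter_length_le. }
    (* The bound for the whole sample as a function of the first letter alone, with [K] still
       counting the ones before that draw. *)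
    set (F := fun x : bool => cc * exp (lam * INR m * K / N + V) * (if x then exp (lam * (INR n / N)) else 1)).
    apply Rle_trans with (Rsum (fun p => F (fst p)) (picks b)).
    + apply Rsum_le. intros [x r] Hin. apply picks_spec in Hin as [Hl Ho]. cbn [fst snd].
      assert (Hr : length r = (m + n)%nat) by lia. specialize (IH r Hr).
      fold N V cc in IH. unfold F, K. rewrite Ho.
      destruct x; cbn [weight].
      * eapply Rle_trans; [apply Rmult_le_compat_l; [left; apply exp_pos|exact IH]|].
        right. rewrite plus_INR. cbn [INR].
        replace (lam * INR m * (1 + INR (ones r)) / N + V)
          with ((lam * INR m * INR (ones r) / N + V) + lam * (INR m / N)) by (field; lra).
        rewrite exp_plus.
        (* Drawing a one contributes [lam]. The share [lam m / N] compensates for the one missing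
           from the remainder, and the share [lam n / N] is the step handed to the two-point
           estimate. *)
        assert (El : exp lam = exp (lam * (INR m / N)) * exp (lam * (INR n / N)))
          by (rewrite <- exp_plus; f_equal; rewrite ENmn; field; lra).
        rewrite El, !exp_plus. ring.
      * rewrite Rmult_1_l, Rmult_1_r. exact IH.
    + rewrite Rsum_picks. fold K. rewrite Hb. cbn [Nat.add]. rewrite EN. unfold F.
      replace (K * (cc * exp (lam * INR m * K / N + V) * exp (lam * (INR n / N))) +
        (N + 1 - K) * (cc * exp (lam * INR m * K / N + V) * 1))
        with ((N + 1) * cc * (exp (lam * INR m * K / N + V) *
          (1 - K / (N + 1) + K / (N + 1) * exp (lam * (INR n / N))))) by (field; lra).
      apply Rmult_le_compat_l.
      { apply Rmult_le_pos; [lra|left; apply C_pos]. }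
      (* Here [p = K / (N + 1)] and [u = lam n / N]: the term [p u] completes the mean for [m + 1]
         draws, and [u^2 / 8] supplies the new summand of [variance]. *)
      eapply Rle_trans; [apply Rmult_le_compat_l; [left; apply exp_pos|apply hoeffding_two_point]|].
      * split; [apply Rmult_le_pos; [lra|left; apply Rinv_0_lt_compat; lra]|].
        apply (Rmult_le_reg_r (N + 1)); [lra|]. unfold Rdiv. rewrite Rmult_assoc, Rinv_l; lra.
      * apply Rmult_le_pos; [exact Hlam|]. apply Rmult_le_pos; [apply pos_INR|].
        left; apply Rinv_0_lt_compat, HN.
      * rewrite <- exp_plus. right. f_equal. unfold V. cbn [variance]. fold N.
        rewrite S_INR. rewrite ENmn in *. field. lra.
Qed.

(** With [x = m] and [y = n], raising [m] by one increases the bound by the new summand plus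
    [x y / ((x + y)^2 (x + 1 + y))], so the induction closes; at [m = 1] there is equality. *)
Lemma variance_le n m : (1 <= n)%nat ->
  variance n m <= INR m * (INR n + 1) / (INR m + INR n).
Proof.
  intros Hn. assert (Hn' : 1 <= INR n) by (apply (le_INR 1); lia).
  induction m as [|m IH]; [simpl; unfold Rdiv; lra|].
  cbn [variance]. rewrite S_INR, plus_INR.
  pose proof (pos_INR m) as Hm. set (x := INR m) in *. set (y := INR n) in *.
  destruct m as [|m'].
  { replace x with 0 in * by reflexivity. cbn [variance]. right. field. lra. }
  apply Rle_trans with (y ^ 2 / (x + y) ^ 2 + x * (y + 1) / (x + y)); [lra|].
  apply Rminus_le.
  replace (y ^ 2 / (x + y) ^ 2 + x * (y + 1) / (x + y) - (x + 1) * (y + 1) / (x + 1 + y))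
    with (- (y * x) / ((x + y) ^ 2 * (x + 1 + y))) by (field; lra).
  unfold Rdiv. rewrite <- Ropp_mult_distr_l.
  assert (0 <= y * x * / ((x + y) ^ 2 * (x + 1 + y))); [|lra].
  apply Rmult_le_pos; [nra|]. left; apply Rinv_0_lt_compat. apply Rmult_lt_0_compat; [|lra].
  apply pow_lt; lra.
Qed.

(** * Masks as random samples *)

Fixpoint cnt (t b : list bool) : nat :=
  match t, b with
  | true :: t', true :: b' => S (cnt t' b')
  | _ :: t', _ :: b' => cnt t' b'
  | _, _ => O
  end.

Lemma masks_S N m :
  masks (S N) m = map (cons false) (masks N m) ++
    match m with O => nil | S m' => map (cons true) (masks N m') end.
Proof.
  assert (F : forall (f : list bool -> bool) x l,
    filter f (map (cons x) l) = map (cons x) (filter (fun s => f (x :: s)) l)).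
  { intros f x l; induction l as [|y l IH]; simpl; [reflexivity|].
    destruct (f (x :: y)); simpl; rewrite IH; reflexivity. }
  unfold masks. cbn [bits]. rewrite filter_app, !F. f_equal.
  destruct m as [|m]; simpl; [|reflexivity].
  induction (bits N); simpl; auto.
Qed.

(** Expanding the symmetric polynomial over subsets identifies it with the unnormalised generating
    function of [cnt t b] for a uniform mask [t]; the recursion follows the first entry. *)
Lemma esym_masks z b m :
  esym z b m = Rsum (fun t => z ^ cnt t b) (masks (length b) m).
Proof.
  revert m; induction b as [|x b IH]; intros m.
  - destruct m; simpl; lra.
  - cbn [length]. rewrite masks_S, Rsum_app, Rsum_map.
    assert (E : Rsum (fun t => z ^ cnt (false :: t) (x :: b)) (masks (length b) m) = esym z b m)
      by (rewrite IH; destruct x; reflexivity).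
    rewrite E. destruct m as [|m]; [rewrite !esym_0; simpl; ring|].
    rewrite Rsum_map, (Rsum_ext _ (fun t => weight z x * z ^ cnt t b)).
    + rewrite Rsum_scal, <- IH. cbn [esym]. ring.
    + intros t _. destruct x; simpl; ring.
Qed.

Lemma length_masks n m : INR (length (masks (m + n) m)) = Binomial.C (m + n) m.
Proof.
  pose proof (esym_1 n m (repeat true (m + n)) (repeat_length _ _)) as E.
  rewrite <- E, esym_masks, repeat_length.
  rewrite (Rsum_ext _ (fun _ => 1)) by (intros; apply pow1). rewrite Rsum_const. ring.
Qed.

(** Chernoff's method: the indicator is at most [exp (lam (cnt t b - mean - s))], whose sum over the
    masks is bounded by [esym_exp_le]. *)
Lemma serfling n m b s : (1 <= m)%nat -> (1 <= n)%nat -> 0 <= s -> length b = (m + n)%nat ->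
  Rsum (fun t => if Rle_dec (INR m * INR (ones b) / INR (m + n) + s) (INR (cnt t b)) then 1 else 0)
    (masks (m + n) m)
  <= Binomial.C (m + n) m * exp (- (2 * s ^ 2 * (INR m + INR n) / (INR m * (INR n + 1)))).
Proof.
  intros Hm Hn Hs Hb.
  assert (Hm' : 1 <= INR m) by (apply (le_INR 1); lia).
  assert (Hn' : 1 <= INR n) by (apply (le_INR 1); lia).
  set (V := INR m * (INR n + 1) / (INR m + INR n)).
  assert (HV : 0 < V) by (unfold V; apply Rdiv_lt_0_compat; [apply Rmult_lt_0_compat|]; lra).
  (* The minimiser of [lam^2 V / 8 - lam s], with minimum [- 2 s^2 / V]. *)
  set (lam := 4 * s / V).
  assert (Hlam : 0 <= lam) by (apply Rmult_le_pos; [lra|left; apply Rinv_0_lt_compat, HV]).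
  set (mean := INR m * INR (ones b) / INR (m + n)).
  apply Rle_trans with (Rsum (fun t => exp (- lam * (mean + s)) * exp lam ^ cnt t b) (masks (m + n) m)).
  - apply Rsum_le; intros t _.
    assert (E : exp lam ^ cnt t b = exp (lam * INR (cnt t b))).
    { induction (cnt t b) as [|c IH]; [simpl; rewrite Rmult_0_r, exp_0; reflexivity|].
      rewrite S_INR, Rmult_plus_distr_l, exp_plus, <- IH. simpl. rewrite Rmult_1_r. ring. }
    rewrite E, <- exp_plus. destruct Rle_dec as [H|]; [|left; apply exp_pos].
    pose proof (Rmult_le_compat_l lam _ _ Hlam H) as H'.
    eapply Rle_trans; [|apply exp_ineq1_le]. lra.
  - rewrite Rsum_scal. rewrite <- Hb at 1. rewrite <- esym_masks.
    eapply Rle_trans; [apply Rmult_le_compat_l; [left; apply exp_pos|apply (esym_exp_le n); assumption]|].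
    rewrite Rmult_comm, Rmult_assoc. apply Rmult_le_compat_l; [left; apply C_pos|].
    rewrite <- exp_plus.
    assert (Hx : lam * INR m * INR (ones b) / INR (m + n) + lam ^ 2 / 8 * variance n m + - lam * (mean + s)
      <= - (2 * s ^ 2 * (INR m + INR n) / (INR m * (INR n + 1)))).
    { replace (lam * INR m * INR (ones b) / INR (m + n)) with (lam * mean)
        by (unfold mean; field; apply not_0_INR; lia).
      assert (lam ^ 2 / 8 * variance n m <= lam ^ 2 / 8 * V).
      { apply Rmult_le_compat_l; [|apply variance_le; assumption].
        pose proof (pow2_ge_0 lam). lra. }
      replace (2 * s ^ 2 * (INR m + INR n) / (INR m * (INR n + 1))) with (lam * s - lam ^ 2 / 8 * V).
      - lra.
      - unfold lam, V. field. lra. }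
    destruct Hx as [Hx| ->]; [left; apply exp_increasing, Hx | right; reflexivity].
Qed.

(** * Product bases and partial measurements *)

Lemma in_bits k x : In x (bits k) <-> length x = k.
Proof.
  revert x; induction k as [|k IH]; intros x; simpl.
  - split; [intros [<-|[]]; reflexivity|]. destruct x; [auto|discriminate].
  - rewrite in_app_iff, !in_map_iff. split.
    + intros [[y [<- H]]|[y [<- H]]]; apply IH in H; simpl; lia.
    + destruct x as [|b x]; [discriminate|]. intros H. injection H as H. apply IH in H.
      destruct b; [right|left]; exists x; auto.
Qed.

Lemma length_bits k : INR (length (bits k)) = 2 ^ k.
Proof.
  induction k as [|k IH]; [reflexivity|].
  cbn [bits]. rewrite length_app, !length_map, plus_INR, IH. simpl. ring.
Qed.

Lemma Csum_bits_S k F :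
  Csum F (bits (S k)) = Cadd (Csum (fun x => F (false :: x)) (bits k)) (Csum (fun x => F (true :: x)) (bits k)).
Proof. cbn [bits]. rewrite Csum_app, !Csum_map. reflexivity. Qed.

Lemma Rsum_Cre {A} (f : A -> R) l : Rsum f l = Cre (Csum (fun x => mkC (f x) 0) l).
Proof. rewrite Cre_Csum. reflexivity. Qed.

Lemma inner_prodvec_cons k mu nu x q y j :
  inner (S k) (prodvec mu (x :: q)) (prodvec nu (y :: j)) =
  Cmul (qinner mu nu x y) (inner k (prodvec mu q) (prodvec nu j)).
Proof.
  unfold inner. rewrite Csum_bits_S. unfold qinner. cbn [prodvec Csum fold_right].
  transitivity (Cadd
    (Cmul (Cmul (Cconj (mu x false)) (nu y false)) (Csum (fun i => Cmul (Cconj (prodvec mu q i)) (prodvec nu j i)) (bits k)))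
    (Cmul (Cmul (Cconj (mu x true)) (nu y true)) (Csum (fun i => Cmul (Cconj (prodvec mu q i)) (prodvec nu j i)) (bits k)))).
  - rewrite <- !Csum_mul_l. f_equal; apply Csum_ext; intros i _; rewrite Cconj_mul; ring.
  - unfold Csum. ring.
Qed.

Lemma prodvec_onb k mu : qubit_onb mu -> onb k (prodvec mu).
Proof.
  intros Hmu. induction k as [|k IH]; intros q j Hq Hj; apply in_bits in Hq, Hj.
  - destruct q; [|discriminate]. destruct j; [|discriminate].
    rewrite lbeq_refl. unfold inner. cbn. apply cplx_ext; simpl; ring.
  - destruct q as [|x q]; [discriminate|]. destruct j as [|y j]; [discriminate|].
    injection Hq as Hq. injection Hj as Hj. apply in_bits in Hq, Hj.
    rewrite inner_prodvec_cons, (IH q j Hq Hj).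
    change (qinner mu mu x y) with (Csum (fun b => Cmul (Cconj (mu x b)) (mu y b)) (false :: true :: nil)).
    rewrite Hmu. unfold lbeq.
    destruct (list_eq_dec Bool.bool_dec q j), (list_eq_dec Bool.bool_dec (x :: q) (y :: j)),
      (Bool.eqb x y) eqn:E; try ring; exfalso.
    all: try apply Bool.eqb_prop in E; try (apply Bool.eqb_false_iff in E); congruence.
Qed.

Lemma Cnorm2_nonneg z : 0 <= Cnorm2 z.
Proof. unfold Cnorm2. nra. Qed.
Lemma Cnorm2_mul z w : Cnorm2 (Cmul z w) = Cnorm2 z * Cnorm2 w.
Proof. unfold Cnorm2; simpl; ring. Qed.

Lemma max_list_ge x l : In x l -> x <= max_list l.
Proof.
  destruct l as [|y l]; [simpl; tauto|]. cbn [max_list].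
  assert (H : y <= fold_right Rmax y l) by (induction l; simpl; [lra|eapply Rle_trans; [eassumption|apply Rmax_r]]).
  intros [<-|Hx]; [exact H|]. clear H. induction l as [|z l IH]; [destruct Hx|].
  destruct Hx as [<-|Hx]; simpl; [apply Rmax_l|eapply Rle_trans; [apply IH, Hx|apply Rmax_r]].
Qed.

Lemma max_list_le b l : l <> nil -> (forall x, In x l -> x <= b) -> max_list l <= b.
Proof.
  destruct l as [|y l]; [congruence|]. intros _ H. cbn [max_list].
  assert (Hy : y <= b) by (apply H; left; reflexivity).
  assert (Hl : forall x, In x l -> x <= b) by (intros; apply H; right; assumption).
  clear H. induction l as [|z l IH]; simpl; [exact Hy|].
  apply Rmax_lub; [apply Hl; left; reflexivity|apply IH; intros; apply Hl; right; assumption].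
Qed.

Lemma Cnorm2_qinner_le mu nu x y : Cnorm2 (qinner mu nu x y) <= overlap mu nu.
Proof.
  apply max_list_ge. apply in_map_iff. exists (x, y). split; [reflexivity|].
  destruct x, y; simpl; tauto.
Qed.

Lemma Cnorm2_inner_prodvec_le k mu nu q j : In q (bits k) -> In j (bits k) ->
  Cnorm2 (inner k (prodvec mu q) (prodvec nu j)) <= overlap mu nu ^ k.
Proof.
  revert q j; induction k as [|k IH]; intros q j Hq Hj; apply in_bits in Hq, Hj.
  - destruct q; [|discriminate]. destruct j; [|discriminate]. unfold Cnorm2, inner. simpl. lra.
  - destruct q as [|x q]; [discriminate|]. destruct j as [|y j]; [discriminate|].
    injection Hq as Hq. injection Hj as Hj. apply in_bits in Hq, Hj.
    rewrite inner_prodvec_cons, Cnorm2_mul. simpl.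
    apply Rmult_le_compat; auto using Cnorm2_nonneg, Cnorm2_qinner_le.
Qed.

(** * Splitting the qubits along a mask *)

Lemma in_masks N m t : In t (masks N m) <-> ones t = m /\ length t = N.
Proof.
  unfold masks. rewrite filter_In, in_bits, Nat.eqb_eq. unfold ones. tauto.
Qed.

Lemma ones_le_length t : (ones t <= length t)%nat.
Proof. apply filter_length_le. Qed.

(** For a fixed mask, [merge t] is a bijection from pairs of sampled and remaining strings to full
    strings; the induction peels off one position of the mask at a time. *)
Lemma Csum_merge t m n F : ones t = m -> length t = (m + n)%nat ->
  Csum F (bits (m + n)) = Csum (fun q => Csum (fun j => F (merge t q j)) (bits n)) (bits m).
Proof.
  revert m n F; induction t as [|[] t IH]; intros m n F Ho Hl; cbn [length] in Hl.
  - unfold ones in Ho; simpl in Ho. subst m. simpl in Hl. subst n. simpl. ring.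
  - change (S (ones t) = m) in Ho. subst m. cbn [Nat.add] in Hl |- *. injection Hl as Hl.
    rewrite !Csum_bits_S. f_equal;
      [rewrite (IH _ n (fun x => F (false :: x)) eq_refl Hl) |
       rewrite (IH _ n (fun x => F (true :: x)) eq_refl Hl)]; reflexivity.
  - change (ones t = m) in Ho. subst m. pose proof (ones_le_length t).
    destruct n as [|n]; [lia|]. rewrite Nat.add_succ_r in Hl |- *. injection Hl as Hl.
    rewrite Csum_bits_S.
    rewrite (IH _ n (fun x => F (false :: x)) eq_refl Hl), (IH _ n (fun x => F (true :: x)) eq_refl Hl).
    rewrite <- Csum_add. apply Csum_ext; intros q _. rewrite Csum_bits_S. reflexivity.
Qed.

Lemma Rsum_merge t m n f : ones t = m -> length t = (m + n)%nat ->
  Rsum f (bits (m + n)) = Rsum (fun q => Rsum (fun j => f (merge t q j)) (bits n)) (bits m).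
Proof.
  intros Ho Hl. rewrite Rsum_Cre, (Csum_merge t m n _ Ho Hl), Cre_Csum.
  apply Rsum_ext; intros q _. symmetry. apply Rsum_Cre.
Qed.

Lemma prodvec_merge mu t : forall q j x y,
  length q = ones t -> length x = ones t ->
  (length q + length j)%nat = length t -> (length x + length y)%nat = length t ->
  prodvec mu (merge t q j) (merge t x y) = Cmul (prodvec mu q x) (prodvec mu j y).
Proof.
  induction t as [|[] t IH]; intros q j x y Hq Hx Hj Hy.
  - destruct q, x, j, y; simpl in *; try lia. simpl. ring.
  - change (ones (true :: t)) with (S (ones t)) in *.
    destruct q as [|b q]; [discriminate|]. destruct x as [|b' x]; [discriminate|].
    simpl in Hq, Hx, Hj, Hy. cbn [merge prodvec]. rewrite IH by lia. ring.
  - change (ones (false :: t)) with (ones t) in *. pose proof (ones_le_length t).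
    destruct j as [|b j]; [simpl in *; lia|]. destruct y as [|b' y]; [simpl in *; lia|].
    simpl in Hj, Hy. cbn [merge prodvec]. rewrite IH by lia. ring.
Qed.

(** Reads off the positions selected by [t]. Applied to [t] and to its negation it inverts [merge],
    which allows a tensor product vector to be defined on full strings. *)
Fixpoint sel (t x : list bool) : list bool :=
  match t, x with
  | true :: t', b :: x' => b :: sel t' x'
  | false :: t', _ :: x' => sel t' x'
  | _, _ => nil
  end.

Lemma sel_merge t : forall q j,
  length q = ones t -> (length q + length j)%nat = length t ->
  sel t (merge t q j) = q /\ sel (map negb t) (merge t q j) = j.
Proof.
  induction t as [|[] t IH]; intros q j Hq Hj.
  - destruct q, j; simpl in *; try lia. auto.
  - change (ones (true :: t)) with (S (ones t)) in *.
    destruct q as [|b q]; [discriminate|]. simpl in Hq, Hj. cbn [merge sel map negb].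
    destruct (IH q j) as [-> ->]; try lia. auto.
  - change (ones (false :: t)) with (ones t) in *. pose proof (ones_le_length t).
    destruct j as [|b j]; [simpl in *; lia|]. simpl in Hj. cbn [merge sel map negb].
    destruct (IH q j) as [-> ->]; try lia. auto.
Qed.

Section Post.
Variables (m n : nat) (mu : bool -> bool -> cplx) (rho : Mat) (t q : list bool).
Hypotheses (Ht : In t (masks (m + n) m)) (Hq : In q (bits m)) (Hmu : qubit_onb mu)
  (Hrho : density (m + n) rho).

(** [V] plays the role of the tensor product of [mu_q] on [t] with [v] on the other qubits. It is
    constrained on merged strings only, so each use may choose a convenient formula for it. *)
Lemma quad_post (v V : Vec) :
  (forall x j, In x (bits m) -> In j (bits n) -> V (merge t x j) = Cmul (prodvec mu q x) (v j)) ->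
  quad n (post m mu rho t q) v = quad (m + n) rho V.
Proof using Ht.
  intros HV. apply in_masks in Ht as [Ho Hl]. unfold quad.
  rewrite (Csum_merge t m n _ Ho Hl). symmetry. rewrite Csum_swap. symmetry.
  apply Csum_ext; intros j Hj.
  transitivity (Csum (fun x => Csum (fun j' => Cmul (Cmul (Cconj (v j))
    (Csum (fun x' => Cmul (Cmul (Cconj (prodvec mu q x)) (rho (merge t x j) (merge t x' j'))) (prodvec mu q x')) (bits m)))
    (v j')) (bits n)) (bits m)).
  - rewrite Csum_swap. apply Csum_ext; intros j' _. unfold post.
    rewrite Csum_mul_r, Csum_mul_l. reflexivity.
  - apply Csum_ext; intros x Hx. rewrite (Csum_merge t m n _ Ho Hl), Csum_swap.
    apply Csum_ext; intros j' Hj'. rewrite <- Csum_mul_l, <- Csum_mul_r.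
    apply Csum_ext; intros x' Hx'. rewrite !HV, Cconj_mul by assumption. ring.
Qed.

Lemma quad_post_prodvec j : In j (bits n) ->
  quad n (post m mu rho t q) (prodvec mu j) = quad (m + n) rho (prodvec mu (merge t q j)).
Proof using Ht Hq.
  intros Hj. apply quad_post. intros x j' Hx Hj'.
  apply in_masks in Ht as [Ho Hl]. apply in_bits in Hq, Hj, Hx, Hj'.
  apply prodvec_merge; lia.
Qed.

Lemma post_hermitian : hermitian n (post m mu rho t q).
Proof using Ht Hrho.
  intros j j' Hj Hj'. unfold post. rewrite Cconj_Csum, Csum_swap.
  apply Csum_ext; intros x Hx. rewrite Cconj_Csum. apply Csum_ext; intros x' Hx'.
  destruct Hrho as (HH & _ & _). apply in_masks in Ht as [Ho Hl].
  apply in_bits in Hj, Hj', Hx, Hx'.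
  assert (Hlen : forall q j, length q = m -> length j = n -> In (merge t q j) (bits (m + n))).
  { intros q0 j0 H1 H2. apply in_bits. rewrite <- Hl. clear.
    revert q0 j0. induction t as [|[] t0 IH]; intros q0 j0; [reflexivity| |]; simpl.
    - destruct q0; simpl; rewrite IH; reflexivity.
    - destruct j0; simpl; rewrite IH; reflexivity. }
  rewrite (HH (merge t x j) (merge t x' j')) by auto.
  rewrite !Cconj_mul, Cconj_conj. ring.
Qed.

Lemma post_psd : psd n (post m mu rho t q).
Proof using Ht Hrho.
  intros v. destruct Hrho as (_ & HP & _).
  rewrite (quad_post v (fun x => Cmul (prodvec mu q (sel t x)) (v (sel (map negb t) x)))); [apply HP|].
  intros x j Hx Hj. apply in_masks in Ht as [Ho Hl]. apply in_bits in Hx, Hj.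
  destruct (sel_merge t x j) as [-> ->]; try lia. reflexivity.
Qed.

(** Evaluating the trace in the product basis of [mu] shows that the outcome on [t] is a marginal of
    the outcome of measuring all qubits with [mu], a distribution that does not depend on [t]. This
    reduces the sampling question to a classical one. *)
Lemma prob_out_merge : prob_out m n mu rho t q =
  Rsum (fun j => Cre (quad (m + n) rho (prodvec mu (merge t q j)))) (bits n).
Proof using Ht Hq Hmu.
  unfold prob_out.
  rewrite <- (sum_quad_complete n (post m mu rho t q) (prodvec mu) (Spectral.onb_complete (prodvec_onb n mu Hmu))).
  rewrite Cre_Csum. apply Rsum_ext; intros j Hj. rewrite quad_post_prodvec by assumption. reflexivity.
Qed.

Lemma quad_post_state v : Cre (quad n (post_state m n mu rho t q) v) =
  / prob_out m n mu rho t q * Cre (quad n (post m mu rho t q) v).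
Proof using.
  unfold quad, post_state. rewrite !Cre_Csum, <- Rsum_scal. apply Rsum_ext; intros x _.
  rewrite !Cre_Csum, <- Rsum_scal. apply Rsum_ext; intros y _. cbn -[post]. ring.
Qed.

Lemma post_state_density : 0 < prob_out m n mu rho t q ->
  density n (post_state m n mu rho t q).
Proof using Ht Hrho.
  intros Hp. split; [|split].
  - intros j j' Hj Hj'. unfold post_state. rewrite (post_hermitian j j' Hj Hj').
    apply cplx_ext; simpl; ring.
  - intros v. rewrite quad_post_state. apply Rmult_le_pos; [|apply post_psd].
    left; apply Rinv_0_lt_compat, Hp.
  - unfold post_state.
    rewrite (Csum_ext _ (fun x => Cmul (mkC (/ prob_out m n mu rho t q) 0) (post m mu rho t q x x)))
      by (intros; apply Cscale_mul).
    rewrite Csum_mul_l.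
    assert (E : Csum (fun x => post m mu rho t q x x) (bits n) = mkC (prob_out m n mu rho t q) 0).
    { apply cplx_ext; [reflexivity|]. cbn -[post Csum].
      pose proof (Cconj_Csum (fun x => post m mu rho t q x x) (bits n)) as E.
      rewrite (Csum_ext (fun x => Cconj _) (fun x => post m mu rho t q x x)) in E.
      - apply (f_equal Cim) in E. cbn -[post Csum] in E. lra.
      - intros x Hx. symmetry. apply post_hermitian; assumption. }
    rewrite E. apply cplx_ext; cbn -[prob_out]; field; lra.
Qed.
End Post.

(** * Bounds on the min-entropy *)

Lemma bits_nonnil k : bits k <> nil.
Proof. intros E. pose proof (length_bits k) as H. rewrite E in H. simpl in H. pose proof (pow_lt 2 k). lra. Qed.

(** The outcome probabilities sum to 1, so the largest is at least [2^-k]. Thus [Hmin] takes the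
    logarithm of a positive number and is at most [k], which makes the smoothing supremum finite. *)
Lemma max_pmeas_ge k nu sigma : density k sigma -> qubit_onb nu ->
  1 <= 2 ^ k * max_list (map (pmeas k nu sigma) (bits k)).
Proof.
  intros HD Hnu.
  rewrite <- (Cre_sum_quad k sigma HD _ (Spectral.onb_complete (prodvec_onb k nu Hnu))).
  rewrite <- length_bits, <- Rsum_const. apply Rsum_le; intros j Hj.
  apply max_list_ge. apply (in_map (pmeas k nu sigma)), Hj.
Qed.

Lemma ln2_pos : 0 < ln 2.
Proof. rewrite <- ln_1. apply ln_increasing; lra. Qed.

Lemma max_pmeas_pos k nu sigma : density k sigma -> qubit_onb nu ->
  0 < max_list (map (pmeas k nu sigma) (bits k)).
Proof.
  intros HD Hnu. pose proof (max_pmeas_ge k nu sigma HD Hnu). pose proof (pow_lt 2 k ltac:(lra)). nra.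
Qed.

Lemma Hmin_le k nu sigma : density k sigma -> qubit_onb nu -> Hmin k nu sigma <= INR k.
Proof.
  intros HD Hnu. pose proof (max_pmeas_ge k nu sigma HD Hnu) as H.
  pose proof (max_pmeas_pos k nu sigma HD Hnu) as Hp.
  unfold Hmin, log2. set (M := max_list _) in *.
  assert (0 <= INR k * ln 2 + ln M).
  { rewrite <- ln_pow, <- ln_mult by (try apply pow_lt; lra). rewrite <- ln_1.
    destruct H as [H|<-]; [left; apply ln_increasing; lra|lra]. }
  pose proof ln2_pos. apply (Rmult_le_reg_r (ln 2)); [assumption|].
  replace (- (ln M / ln 2) * ln 2) with (- ln M) by (field; lra). lra.
Qed.

Lemma Hmin_ge k nu sigma b : density k sigma -> qubit_onb nu ->
  (forall j, In j (bits k) -> pmeas k nu sigma j <= exp b) -> - b / ln 2 <= Hmin k nu sigma.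
Proof.
  intros HD Hnu Hb. pose proof (max_pmeas_pos k nu sigma HD Hnu) as Hp.
  unfold Hmin, log2.
  assert (H : max_list (map (pmeas k nu sigma) (bits k)) <= exp b).
  { apply max_list_le.
    - pose proof (bits_nonnil k). destruct (bits k); [congruence|discriminate].
    - intros x Hx. apply in_map_iff in Hx as [j [<- Hj]]. apply Hb, Hj. }
  set (M := max_list _) in *. pose proof ln2_pos.
  assert (ln M <= b).
  { rewrite <- (ln_exp b). destruct H as [H| ->]; [left; apply ln_increasing; assumption|lra]. }
  apply (Rmult_le_reg_r (ln 2)); [assumption|].
  replace (- (ln M / ln 2) * ln 2) with (- ln M) by (field; lra).
  replace (- b / ln 2 * ln 2) with (- b) by (field; lra). lra.
Qed.

(** * Volume of Hamming balls *)

Definition dist (a : bool) (q : list bool) : nat := length (filter (fun b => negb (Bool.eqb b a)) q).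

(** The total mass of the product distribution in which a letter differs from [a] with probability
    [exp x]. *)
Lemma Rsum_exp_dist a x y n : exp x + exp y = 1 ->
  Rsum (fun j => exp (INR (dist a j) * x + (INR n - INR (dist a j)) * y)) (bits n) = 1.
Proof.
  intros Hxy. induction n as [|n IH].
  - unfold dist; simpl. replace (0 * x + (0 - 0) * y) with 0 by ring. rewrite exp_0. ring.
  - cbn [bits]. rewrite Rsum_app, !Rsum_map.
    rewrite (Rsum_ext _ (fun j => exp (if Bool.eqb false a then y else x) *
       exp (INR (dist a j) * x + (INR n - INR (dist a j)) * y))).
    rewrite (Rsum_ext (fun j => exp (INR (dist a (true :: j)) * x + _)) (fun j => exp (if Bool.eqb true a then y else x) *
       exp (INR (dist a j) * x + (INR n - INR (dist a j)) * y))).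
    + rewrite !Rsum_scal, IH. destruct a; simpl; lra.
    + intros j _. rewrite <- exp_plus. f_equal. unfold dist. cbn [filter]. rewrite S_INR.
      destruct (Bool.eqb true a); cbn [negb length]; rewrite ?S_INR; ring.
    + intros j _. rewrite <- exp_plus. f_equal. unfold dist. cbn [filter]. rewrite S_INR.
      destruct (Bool.eqb false a); cbn [negb length]; rewrite ?S_INR; ring.
Qed.

Definition ball (a : bool) (x : R) (j : list bool) : bool :=
  if Rle_dec (wa a j) x then true else false.

(** For [x <= 1/2], give each letter probability [x] of differing from [a]. Since
    [ln x <= ln (1 - x)], the probability of a string decreases with its distance, so every string
    of the ball has probability at least [2^(- n Hbar x)], and the total mass is 1. For [x > 1/2]
    the bound is the number of all strings. *)
Lemma card_ball_le a n x : (1 <= n)%nat -> 0 < x ->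
  INR (length (filter (ball a x) (bits n))) <= exp (INR n * Hbar x * ln 2).
Proof.
  intros Hn Hx. unfold Hbar. destruct (Rlt_dec x 0); [lra|]. destruct (Rlt_dec (1 / 2) x) as [Hh|Hh].
  - eapply Rle_trans; [apply le_INR, filter_length_le|].
    rewrite length_bits, Rmult_1_r, <- ln_pow, exp_ln by (try apply pow_lt; lra). lra.
  - assert (Hn' : 1 <= INR n) by (apply (le_INR 1); lia).
    pose proof ln2_pos.
    set (h := INR n * (- x * log2 x - (1 - x) * log2 (1 - x)) * ln 2).
    assert (Eh : h = - (INR n * x * ln x + INR n * (1 - x) * ln (1 - x))).
    { unfold h, log2. field. lra. }
    assert (Hln : ln x <= ln (1 - x)).
    { destruct (Req_dec x (1 - x)) as [<-|]; [lra|]. left; apply ln_increasing; lra. }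
    pose proof (Rsum_exp_dist a (ln x) (ln (1 - x)) n) as E.
    rewrite !exp_ln in E by lra. specialize (E ltac:(lra)).
    rewrite (Rsum_split _ (ball a x)) in E.
    assert (H0 : forall l, 0 <= Rsum (fun j => exp (INR (dist a j) * ln x + (INR n - INR (dist a j)) * ln (1 - x))) l)
      by (intros; apply Rsum_nonneg; intros; left; apply exp_pos).
    assert (H1 : Rsum (fun _ => exp (- h)) (filter (ball a x) (bits n)) <= 1).
    { apply Rle_trans with (Rsum (fun j => exp (INR (dist a j) * ln x + (INR n - INR (dist a j)) * ln (1 - x))) (filter (ball a x) (bits n))).
      - apply Rsum_le; intros j Hj. apply filter_In in Hj as [Hj Hb]. apply in_bits in Hj.
        unfold ball in Hb. destruct Rle_dec as [Hw|]; [|discriminate].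
        unfold wa in Hw. fold (dist a j) in Hw. rewrite Hj in Hw.
        assert (Hd : INR (dist a j) <= INR n * x).
        { apply (Rmult_le_compat_r (INR n)) in Hw; [|lra].
          replace (INR (dist a j) / INR n * INR n) with (INR (dist a j)) in Hw by (field; lra). lra. }
        assert (Hle : - h <= INR (dist a j) * ln x + (INR n - INR (dist a j)) * ln (1 - x)).
        { rewrite Eh. assert (0 <= (INR n * x - INR (dist a j)) * (ln (1 - x) - ln x)) by (apply Rmult_le_pos; lra). lra. }
        destruct Hle as [Hle| ->]; [left; apply exp_increasing, Hle|lra].
      - specialize (H0 (filter (fun j => negb (ball a x j)) (bits n))). lra. }
    rewrite Rsum_const in H1.
    apply (Rmult_le_reg_r (exp (- h))); [apply exp_pos|].
    rewrite <- exp_plus. replace (h + - h) with 0 by ring. rewrite exp_0. exact H1.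
Qed.

(** * Combining the bounds *)

Definition agree (a : bool) (b : list bool) : list bool := map (fun x => Bool.eqb x a) b.

(** Stated with sums in order to avoid truncated subtraction. *)
Lemma agree_merge a t : forall q j,
  length q = ones t -> (length q + length j)%nat = length t ->
  (cnt t (agree a (merge t q j)) + dist a q = length q)%nat /\
  (ones (agree a (merge t q j)) + dist a q + dist a j = length t)%nat.
Proof.
  induction t as [|[] t IH]; intros q j Hq Hj.
  - destruct q, j; simpl in *; try lia. auto.
  - change (ones (true :: t)) with (S (ones t)) in *.
    destruct q as [|b q]; [discriminate|]. simpl in Hq, Hj. cbn [merge].
    destruct (IH q j) as [H1 H2]; try lia.
    unfold agree, ones, dist in *. cbn [map cnt filter].
    destruct (Bool.eqb b a); cbn [negb length]; split; lia.
  - change (ones (false :: t)) with (ones t) in *. pose proof (ones_le_length t).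
    destruct j as [|b j]; [simpl in *; lia|]. simpl in Hj. cbn [merge].
    destruct (IH q j) as [H1 H2]; try lia.
    unfold agree, ones, dist in *. cbn [map cnt filter].
    destruct (Bool.eqb b a); cbn [negb length]; split; lia.
Qed.

(* Letters equal to [a] are counted rather than those that differ, so that an excess of errors
   outside the sample is an upper-tail event for the sampled count. *)
Definition deviation (m n : nat) (a : bool) (delta : R) (t b : list bool) : R :=
  if Rle_dec (INR m * INR (ones (agree a b)) / INR (m + n) + delta * (INR m * INR n / INR (m + n)))
       (INR (cnt t (agree a b)))
  then 1 else 0.

(** With [dq], [dj] the distances of [q], [j], threshold minus count equals [(m n / (m + n)) (dq / m
    + delta - dj / n)]. It is negative exactly when the remainder is atypical, which explains the
    factor [m n / (m + n)] in [deviation]. *)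
Lemma deviation_merge m n a delta t q j : (1 <= m)%nat -> (1 <= n)%nat ->
  In t (masks (m + n) m) -> In q (bits m) -> In j (bits n) ->
  wa a q + delta < wa a j -> deviation m n a delta t (merge t q j) = 1.
Proof.
  intros Hm Hn Ht Hq Hj Hw. apply in_masks in Ht as [Ho Hl]. apply in_bits in Hq, Hj.
  unfold deviation. destruct Rle_dec as [|Hc]; [reflexivity|]. exfalso; apply Hc; clear Hc.
  destruct (agree_merge a t q j) as [H1 H2]; try lia.
  unfold wa in Hw. fold (dist a q) (dist a j) in Hw. rewrite Hq, Hj in Hw.
  apply (f_equal INR) in H1, H2. rewrite plus_INR, Hq in H1.
  rewrite Hl, !plus_INR in H2. rewrite plus_INR.
  assert (Hm' : 1 <= INR m) by (apply (le_INR 1); lia).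
  assert (Hn' : 1 <= INR n) by (apply (le_INR 1); lia).
  set (M := INR m) in *. set (N := INR n) in *.
  set (k := INR (cnt t (agree a (merge t q j)))) in *.
  set (o := INR (ones (agree a (merge t q j)))) in *.
  set (dq := INR (dist a q)) in *. set (dj := INR (dist a j)) in *.
  replace k with (M - dq) by lra. replace o with (M + N - dq - dj) by lra.
  apply Rminus_le.
  replace (M * (M + N - dq - dj) / (M + N) + delta * (M * N / (M + N)) - (M - dq))
    with ((M * N / (M + N)) * (dq / M + delta - dj / N)) by (field; lra).
  assert (0 < M * N / (M + N)) by (apply Rdiv_lt_0_compat; [apply Rmult_lt_0_compat|]; lra).
  nra.
Qed.

(** With this [delta], the exponent in [serfling] is [- L] times
    [2 (m + n + 2) n^2 / ((m + n)^2 (n + 1))]. For [m <= n] this factor is at least 1, with equality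
    at [m = n], and [exp (- L) = eps^2 / 2]. *)
Lemma sum_deviation_le m n a eps b : (1 <= m)%nat -> (m <= n)%nat -> 0 < eps < 1 ->
  In b (bits (m + n)) ->
  Rsum (fun t => deviation m n a (sqrt (INR (m + n + 2) * ln (2 / eps ^ 2) / (INR m * INR (m + n)))) t b)
    (masks (m + n) m) <= Binomial.C (m + n) m * (eps ^ 2 / 2).
Proof.
  intros Hm Hmn He Hb. apply in_bits in Hb.
  assert (Hm' : 1 <= INR m) by (apply (le_INR 1); lia).
  assert (Hmn' : INR m <= INR n) by (apply le_INR; lia).
  set (L := ln (2 / eps ^ 2)).
  assert (Hep : 0 < eps ^ 2 < 1) by (simpl; nra).
  assert (HL : 0 < L).
  { unfold L. rewrite <- ln_1. apply ln_increasing; [lra|].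
    apply (Rmult_lt_reg_r (eps ^ 2)); [lra|]. unfold Rdiv. rewrite Rmult_assoc, Rinv_l; lra. }
  set (delta := sqrt _).
  assert (Hd2 : delta ^ 2 = (INR m + INR n + 2) * L / (INR m * (INR m + INR n))).
  { unfold delta. rewrite !plus_INR. simpl (INR 2). rewrite pow2_sqrt; [reflexivity|].
    apply Rmult_le_pos; [apply Rmult_le_pos; lra|]. left; apply Rinv_0_lt_compat, Rmult_lt_0_compat; lra. }
  assert (Hd : 0 <= delta) by apply sqrt_pos.
  eapply Rle_trans.
  - apply (serfling n m (agree a b) (delta * (INR m * INR n / INR (m + n)))); try lia.
    + apply Rmult_le_pos; [exact Hd|]. rewrite plus_INR. left; apply Rdiv_lt_0_compat; [apply Rmult_lt_0_compat|]; lra.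
    + unfold agree. rewrite length_map. exact Hb.
  - apply Rmult_le_compat_l; [left; apply C_pos|].
    assert (E : eps ^ 2 / 2 = exp (- L)).
    { unfold L. rewrite <- ln_Rinv by (apply Rdiv_lt_0_compat; lra).
      rewrite exp_ln by (apply Rinv_0_lt_compat, Rdiv_lt_0_compat; lra). field. lra. }
    rewrite E, plus_INR.
    replace (2 * (delta * (INR m * INR n / (INR m + INR n))) ^ 2 * (INR m + INR n) / (INR m * (INR n + 1)))
      with (2 * delta ^ 2 * INR m * INR n ^ 2 / ((INR m + INR n) * (INR n + 1))) by (field; lra).
    rewrite Hd2.
    replace (2 * ((INR m + INR n + 2) * L / (INR m * (INR m + INR n))) * INR m * INR n ^ 2 / ((INR m + INR n) * (INR n + 1)))
      with (L * (2 * (INR m + INR n + 2) * INR n ^ 2 / ((INR m + INR n) ^ 2 * (INR n + 1)))) by (field; lra).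
    assert (H1 : 1 <= 2 * (INR m + INR n + 2) * INR n ^ 2 / ((INR m + INR n) ^ 2 * (INR n + 1))).
    { assert (Hden : 0 < (INR m + INR n) ^ 2 * (INR n + 1)) by (apply Rmult_lt_0_compat; [apply pow_lt|]; lra).
      apply (Rmult_le_reg_r ((INR m + INR n) ^ 2 * (INR n + 1))); [exact Hden|].
      unfold Rdiv. rewrite Rmult_assoc, Rinv_l, Rmult_1_l, Rmult_1_r by lra.
      (* Writing [m = n - k] with [0 <= k <= n] turns the inequality into a polynomial whose terms
         all have a visible sign. *)
      set (k := INR n - INR m). replace (INR m) with (INR n - k) by (unfold k; ring).
      assert (0 <= k <= INR n) by (unfold k; lra). set (y := INR n) in *.
      apply Rminus_le.
      replace ((y - k + y) ^ 2 * (y + 1) - 2 * (y - k + y + 2) * y ^ 2)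
        with (- (k * y * (y - k) + k * (y * y) + 3 * (k * y) + k * (y - k))) by ring.
      assert (0 <= k * y) by nra.
      assert (0 <= k * y * (y - k)) by (apply Rmult_le_pos; lra).
      assert (0 <= k * (y * y)) by (apply Rmult_le_pos; nra).
      assert (0 <= k * (y - k)) by (apply Rmult_le_pos; lra). lra. }
    assert (H2 : L <= L * (2 * (INR m + INR n + 2) * INR n ^ 2 / ((INR m + INR n) ^ 2 * (INR n + 1)))) by nra.
    destruct H2 as [H2|H2]; [left; apply exp_increasing; lra|rewrite <- H2; lra].
Qed.

Lemma overlap_nonneg mu nu : 0 <= overlap mu nu.
Proof.
  eapply Rle_trans; [|apply (Cnorm2_qinner_le mu nu true true)]. apply Cnorm2_nonneg.
Qed.

(** The projected state witnesses the smoothed entropy. The hypothesis [r' < 1] leaves positive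
    typical mass to renormalise by, and [kappa] is still free to be balanced against [r']. *)
Lemma smooth_Hmin_project n nu mu D a x kappa b :
  (1 <= n)%nat -> density n D -> qubit_onb mu -> qubit_onb nu -> 0 < x -> 0 < kappa ->
  let r' := Rsum (fun i => Cre (quad n D (prodvec mu i))) (filter (fun j => negb (ball a x j)) (bits n)) in
  r' < 1 -> kappa + (2 + / kappa) * r' <= b ->
  exists h, smooth_Hmin n nu b D h /\ h + INR n * Hbar x >= - INR n * log2 (overlap mu nu).
Proof.
  intros Hn HD Hmu Hnu Hx Hk r' Hr' Hb.
  pose proof (prodvec_onb n mu Hmu) as He.
  assert (Hr : 0 < Rsum (fun i => Cre (quad n D (prodvec mu i))) (filter (ball a x) (bits n))).
  { pose proof (Cre_sum_quad n D HD (prodvec mu) (Spectral.onb_complete He)) as E.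
    rewrite (Rsum_split _ (ball a x)) in E. fold r' in E. lra. }
  set (sigma := project n D (prodvec mu) (ball a x)).
  pose proof (project_density n D (prodvec mu) (ball a x) HD He Hr : density n sigma) as Hs.
  destruct (trace_norm_project n D (prodvec mu) (ball a x) HD He Hr kappa Hk) as (s & Hs1 & Hs2).
  fold r' in Hs2.
  set (P := fun y => exists sg, density n sg /\
    (exists s, trace_norm n (Msub sg D) s /\ s <= b) /\ y = Hmin n nu sg).
  assert (HP : P (Hmin n nu sigma)).
  { exists sigma. split; [exact Hs|]. split; [|reflexivity]. exists s. split; [exact Hs1|lra]. }
  (* The supremum exists: the set contains the value at [sigma] and is bounded by [n]. *)
  destruct (completeness P) as [h Hh].
  - exists (INR n). intros y (sg & Hsg & _ & ->). apply Hmin_le; assumption.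
  - exists (Hmin n nu sigma). exact HP.
  - exists h. split; [exact Hh|].
    assert (H1 : Hmin n nu sigma <= h) by (apply Hh, HP).
    set (c := overlap mu nu).
    assert (Hm : forall j, In j (bits n) -> pmeas n nu sigma j <= exp (INR n * Hbar x * ln 2) * c ^ n).
    { intros j Hj. eapply Rle_trans.
      - apply (quad_project_le n D (prodvec mu) (ball a x) HD Hr (prodvec nu j) (c ^ n)).
        intros i Hi. apply filter_In in Hi as [Hi _]. apply Cnorm2_inner_prodvec_le; assumption.
      - apply Rmult_le_compat_r; [apply pow_le, overlap_nonneg|]. apply card_ball_le; assumption. }
    (* If [c] were 0, then [c^n = 0] because [n >= 1], and all outcome probabilities of [sigma]
       would be at most 0. Positivity is needed before taking [ln c]. *)
    assert (Hc : 0 < c).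
    { destruct (overlap_nonneg mu nu) as [|E]; [assumption|exfalso].
      fold c in E. rewrite <- E in Hm. rewrite pow_i, Rmult_0_r in Hm by lia.
      pose proof (max_pmeas_pos n nu sigma Hs Hnu) as Hp.
      assert (max_list (map (pmeas n nu sigma) (bits n)) <= 0); [|lra].
      apply max_list_le.
      - pose proof (bits_nonnil n). destruct (bits n); [congruence|discriminate].
      - intros y Hy. apply in_map_iff in Hy as [j [<- Hj]]. apply Hm, Hj. }
    assert (H2 : - (INR n * Hbar x * ln 2 + INR n * ln c) / ln 2 <= Hmin n nu sigma).
    { apply Hmin_ge; [assumption|assumption|]. intros j Hj.
      rewrite exp_plus, <- ln_pow, (exp_ln (c ^ n)) by (try apply pow_lt; assumption).
      apply Hm, Hj. }
    pose proof ln2_pos. unfold log2.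
    replace (- (INR n * Hbar x * ln 2 + INR n * ln c) / ln 2) with (- (INR n * Hbar x) - INR n * (ln c / ln 2)) in H2 by (field; lra).
    lra.
Qed.

Lemma Rpower_le_1 x y : 0 < x <= 1 -> 0 <= y -> Rpower x y <= 1.
Proof.
  intros Hx Hy. rewrite <- (Rpower_O x) by lra. unfold Rpower.
  assert (ln x <= 0) by (rewrite <- ln_1; destruct (proj2 Hx) as [H| ->]; [left; apply ln_increasing; lra|lra]).
  destruct (Req_dec (y * ln x) (0 * ln x)) as [->|]; [lra|]. left; apply exp_increasing. nra.
Qed.

Theorem theorem2 :
  forall (epsh eps beta : R) (a : bool) (m n : nat) (rho : Mat)
         (mu nu : bool -> bool -> cplx),
    0 < eps -> eps <= epsh -> 0 < beta < 1/2 ->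
    (1 <= m)%nat -> (m <= n)%nat ->
    density (m + n) rho -> qubit_onb mu -> qubit_onb nu ->
    let delta := sqrt (INR (m + n + 2) * ln (2 / eps ^ 2) / (INR m * INR (m + n))) in
    let c := overlap mu nu in
    Rsum (fun t =>
      Rsum (fun q =>
        / Binomial.C (m + n) m * prob_out m n mu rho t q *
        indicator (exists h,
          smooth_Hmin n nu (2 * eps + 2 * Rpower eps beta) (post_state m n mu rho t q) h /\
          h + INR n * Hbar (wa a q + delta) >= - INR n * log2 c))
      (bits m))
    (masks (m + n) m)
    >= 1 - Rpower epsh (1 - 2 * beta).
Proof.
  intros epsh eps beta a m n rho mu nu Heps Hh Hbeta Hm Hmn Hrho Hmu Hnu delta c.
  (* The joint distribution of the outcomes when all [m + n] qubits are measured with [mu]. *)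
  set (w := fun b => Cre (quad (m + n) rho (prodvec mu b))).
  assert (Hw : forall b, 0 <= w b) by (intros; apply Hrho).
  assert (Hw1 : Rsum w (bits (m + n)) = 1)
    by (apply (Cre_sum_quad (m + n) rho Hrho), Spectral.onb_complete, prodvec_onb, Hmu).
  assert (Hp : forall t q, In t (masks (m + n) m) -> In q (bits m) ->
    prob_out m n mu rho t q = Rsum (fun j => w (merge t q j)) (bits n))
    by (intros; apply prob_out_merge; assumption).
  assert (HC : 0 < / Binomial.C (m + n) m) by (apply Rinv_0_lt_compat, C_pos).
  set (good := fun t q => exists h,
          smooth_Hmin n nu (2 * eps + 2 * Rpower eps beta) (post_state m n mu rho t q) h /\
          h + INR n * Hbar (wa a q + delta) >= - INR n * log2 c).
  apply Rle_ge.
  change (1 - Rpower epsh (1 - 2 * beta) <= Rsum (fun t => Rsum (fun q =>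
    / Binomial.C (m + n) m * prob_out m n mu rho t q * indicator (good t q)) (bits m)) (masks (m + n) m)).
  assert (Hi : forall Q, 0 <= indicator Q) by (intros Q; unfold indicator; destruct excluded_middle_informative; lra).
  (* For [epsh >= 1] the claimed probability is at most 0. Otherwise [eps < 1], as
     [sum_deviation_le] requires. *)
  destruct (Rle_lt_dec 1 epsh) as [H1|H1].
  { apply Rle_trans with 0.
    - assert (1 <= Rpower epsh (1 - 2 * beta)); [|lra].
      rewrite <- (Rpower_O epsh) at 1 by lra. apply Rle_Rpower; lra.
    - apply Rsum_nonneg; intros t Ht; apply Rsum_nonneg; intros q Hq.
      rewrite Hp by assumption. apply Rmult_le_pos; [apply Rmult_le_pos; [lra|]|apply Hi].
      apply Rsum_nonneg; intros; apply Hw. }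
  (* The Markov threshold: [eps^2 / tau] is the desired failure probability, and [tau = eps B^2]
     with [B = eps^beta] keeps [tau / B] small. *)
  set (tau := Rpower eps (1 + 2 * beta)).
  assert (Htau : 0 < tau) by apply exp_pos.
  assert (Hb0 : 0 < Rpower eps beta) by apply exp_pos.
  assert (Htau_eps : tau = eps * (Rpower eps beta * Rpower eps beta)).
  { unfold tau. rewrite <- Rpower_plus, Rpower_plus, Rpower_1 by lra. f_equal. f_equal. ring. }
  assert (Hb1 : Rpower eps beta <= 1) by (apply Rpower_le_1; lra).
  assert (Hm' : 1 <= INR m) by (apply (le_INR 1); lia).
  assert (Hn' : 1 <= INR n) by (apply (le_INR 1); lia).
  assert (Hdelta : 0 < delta).
  { apply sqrt_lt_R0. rewrite !plus_INR. simpl (INR 2). apply Rdiv_lt_0_compat; apply Rmult_lt_0_compat; try lra.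
    rewrite <- ln_1. apply ln_increasing; [lra|].
    assert (Hep : 0 < eps ^ 2 < 1) by (simpl; nra).
    apply (Rmult_lt_reg_r (eps ^ 2)); [lra|]. unfold Rdiv. rewrite Rmult_assoc, Rinv_l; lra. }
  (* A joint mass, not yet divided by the probability of [q], so that it sums over [q] to an
     expectation under [w]. *)
  set (bad := fun t q => Rsum (fun j => w (merge t q j) * deviation m n a delta t (merge t q j)) (bits n)).
  assert (Hdev : forall t b, 0 <= deviation m n a delta t b)
    by (intros; unfold deviation; destruct Rle_dec; lra).
  assert (Hbad : forall t q, 0 <= bad t q)
    by (intros; apply Rsum_nonneg; intros; apply Rmult_le_pos; auto).
  assert (Hgood : forall t q, In t (masks (m + n) m) -> In q (bits m) ->
    0 < prob_out m n mu rho t q -> bad t q <= tau * prob_out m n mu rho t q -> good t q).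
  { intros t q Ht Hq Hpos Hbt. unfold good.
    pose proof (post_state_density m n mu rho t q Ht Hrho Hpos) as HD.
    set (x := wa a q + delta).
    assert (Hx : 0 < x).
    { assert (0 <= wa a q); [|unfold x; lra]. unfold wa. apply in_bits in Hq. rewrite Hq.
      apply Rmult_le_pos; [apply pos_INR|]. left; apply Rinv_0_lt_compat; lra. }
    set (p := prob_out m n mu rho t q) in *.
    assert (Hr : Rsum (fun i => Cre (quad n (post_state m n mu rho t q) (prodvec mu i)))
        (filter (fun j => negb (ball a x j)) (bits n)) <= tau).
    { apply (Rmult_le_reg_l p); [exact Hpos|]. rewrite <- Rsum_scal.
      eapply Rle_trans; [|rewrite Rmult_comm; exact Hbt].
      unfold bad. rewrite (Rsum_split _ (ball a x) (bits n)).
      match goal with |- _ <= ?A + _ => assert (0 <= A) end.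
      { apply Rsum_nonneg; intros; apply Rmult_le_pos; auto. }
      match goal with |- ?B <= _ + ?B' => assert (B <= B'); [|lra] end.
      apply Rsum_le; intros j Hj. apply filter_In in Hj as [Hj Hball].
      rewrite quad_post_state. fold p. rewrite quad_post_prodvec by assumption.
      rewrite deviation_merge; try assumption; try lia.
      - fold (w (merge t q j)). right. field. lra.
      - unfold ball in Hball. destruct Rle_dec; [discriminate|]. fold x. lra. }
    apply (smooth_Hmin_project n nu mu _ a x (Rpower eps beta)); try assumption; try lia.
    - eapply Rle_lt_trans; [exact Hr|]. rewrite Htau_eps. assert (Rpower eps beta * Rpower eps beta <= 1) by nra. nra.
    (* With [kappa = B] the bound is [B + 2 eps B^2 + eps B], and both [eps] and [B] are at most
       1. *)
    - set (B := Rpower eps beta) in *.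
      apply Rle_trans with (B + (2 + / B) * tau).
      + assert (0 < / B) by (apply Rinv_0_lt_compat; lra).
        apply Rplus_le_compat_l, Rmult_le_compat_l; lra.
      + rewrite Htau_eps. replace (B + (2 + / B) * (eps * (B * B))) with (B + 2 * (eps * (B * B)) + eps * B) by (field; lra).
        assert (B * B <= 1) by nra. nra. }
  (* Markov's inequality in pointwise form: the indicator of [good], weighted by the outcome
     probability [p], is at least [p - bad / tau]. *)
  apply Rle_trans with (Rsum (fun t => Rsum (fun q => / Binomial.C (m + n) m * prob_out m n mu rho t q +
     - (/ Binomial.C (m + n) m * / tau) * bad t q) (bits m)) (masks (m + n) m)).
  - rewrite (Rsum_ext _ (fun t => / Binomial.C (m + n) m + - (/ Binomial.C (m + n) m * / tau) *
       Rsum (fun b => w b * deviation m n a delta t b) (bits (m + n)))).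
    + rewrite Rsum_add, Rsum_const, length_masks, Rinv_r by (apply Rgt_not_eq, C_pos).
      (* With the sum over masks innermost, the sampling bound applies to each fixed string [b], and
         [w] averages these bounds. *)
      rewrite Rsum_scal, Rsum_swap.
      assert (Hs : Rsum (fun b => Rsum (fun t => w b * deviation m n a delta t b) (masks (m + n) m)) (bits (m + n))
        <= Binomial.C (m + n) m * (eps ^ 2 / 2)).
      { apply Rle_trans with (Rsum (fun b => (Binomial.C (m + n) m * (eps ^ 2 / 2)) * w b) (bits (m + n))).
        - apply Rsum_le; intros b Hb. rewrite Rsum_scal, Rmult_comm.
          apply Rmult_le_compat_r; [apply Hw|]. apply sum_deviation_le; try assumption; lra.
        - rewrite Rsum_scal, Hw1. lra. }
      apply (Rmult_le_compat_l (/ Binomial.C (m + n) m * / tau)) in Hs;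
        [|left; apply Rmult_lt_0_compat; [lra|apply Rinv_0_lt_compat; lra]].
      replace (/ Binomial.C (m + n) m * / tau * (Binomial.C (m + n) m * (eps ^ 2 / 2))) with (eps ^ 2 * / tau / 2) in Hs
        by (field; split; [lra|apply Rgt_not_eq, C_pos]).
      assert (E : eps ^ 2 * / tau = Rpower eps (1 - 2 * beta)).
      { unfold tau. rewrite <- Rpower_Ropp, <- Rpower_pow, <- Rpower_plus by lra. f_equal. simpl. ring. }
      rewrite E in Hs.
      assert (0 < Rpower eps (1 - 2 * beta)) by apply exp_pos.
      assert (Rpower eps (1 - 2 * beta) <= Rpower epsh (1 - 2 * beta)) by (apply Rle_Rpower_l; lra).
      lra.
    + intros t Ht. pose proof Ht as Ht'. apply in_masks in Ht' as [Ho Hl].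
      rewrite Rsum_add, !Rsum_scal, !(Rsum_merge t m n _ Ho Hl). fold (bad t).
      replace (Rsum (prob_out m n mu rho t) (bits m)) with 1; [unfold bad; ring|].
      rewrite <- Hw1, (Rsum_merge t m n _ Ho Hl). symmetry. apply Rsum_ext; intros q Hq. apply Hp; assumption.
  - apply Rsum_le; intros t Ht; apply Rsum_le; intros q Hq.
    assert (Hp0 : 0 <= prob_out m n mu rho t q)
      by (rewrite Hp by assumption; apply Rsum_nonneg; intros; apply Hw).
    rewrite Rmult_assoc.
    replace (/ Binomial.C (m + n) m * prob_out m n mu rho t q + - (/ Binomial.C (m + n) m * / tau) * bad t q)
      with (/ Binomial.C (m + n) m * (prob_out m n mu rho t q - / tau * bad t q)) by ring.
    apply Rmult_le_compat_l; [lra|].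
    specialize (Hbad t q). specialize (Hgood t q Ht Hq).
    set (p := prob_out m n mu rho t q) in *.
    assert (Hit : 0 < / tau) by (apply Rinv_0_lt_compat; lra).
    assert (0 <= / tau * bad t q) by (apply Rmult_le_pos; lra).
    pose proof (Hi (good t q)) as Hi'.
    pose proof (Rmult_le_pos _ _ Hp0 Hi').
    (* If [bad] exceeds [tau p], the left side is negative. An outcome of probability 0, whose
       normalised state is meaningless, makes it non-positive as well. *)
    destruct (Rle_lt_dec (bad t q) (tau * p)) as [Hle|Hlt].
    + destruct Hp0 as [Hp0|Hp0].
      * specialize (Hgood Hp0 Hle). unfold indicator. destruct excluded_middle_informative; [lra|contradiction].
      * lra.
    + apply (Rmult_lt_compat_l (/ tau)) in Hlt; [|lra].
      rewrite <- Rmult_assoc, Rinv_l, Rmult_1_l in Hlt by lra. lra.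
Qed.
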